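(* Fix $\tau,\tau'\in(0,1)$ with $\tau\neq\tau'$ and let $\theta_{\tau,\tau'}$ be the topological conjugacy between $T_\tau$ and $T_{\tau'}$. Then $$\dim_{\mathrm H}\{x\in[0,1]:\theta_{\tau,\tau'}'(x)\neq0\}=\frac{p_{\tau,\tau'}\log p_{\tau,\tau'}+(1-p_{\tau,\tau'})\log(1-p_{\tau,\tau'})}{p_{\tau,\tau'}\log\tau+(1-p_{\tau,\tau'})\log(1-\tau)},$$ where $$p_{\tau,\tau'}:=\frac{\log(1-\tau')-\log(1-\tau)}{\log\tau-\log(1-\tau)-\log\tau'+\log(1-\tau')} .$$
   Context: For $0<\tau<1$, $T_\tau:[0,1]\to[0,1]$ is the countable Markov map with decreasing linear full branches on each interval $(\tau^k,\tau^{k-1}]$, $k\in\mathbb N=\{1,2,\dots\}$; that is, $T_\tau(x)=\dfrac{\tau^{k-1}-x}{\tau^{k-1}(1-\tau)}$ for $x\in(\tau^k,\tau^{k-1}]$, and $T_\tau(0)=0$. The topological conjugacy $\theta=\theta_{\tau,\tau'}$ is the increasing homeomorphism $\theta:[0,1]\to[0,1]$ with $\theta\circ T_\tau=T_{\tau'}\circ\theta$ (sending the $k$-th branch interval of $T_\tau$ to the $k$-th branch interval of $T_{\tau'}$). The set $\{x:\theta'(x)\ne0\}$ is the set of $x$ for which it is not the case that $\theta'(x)$ exists and equals $0$; it thus includes points where the derivative does not exist or is infinite. $\dim_{\mathrm H}$ is Hausdorff dimension. *)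

(* Defs.v *)
From HB Require Import structures.
From mathcomp Require Import all_boot all_order all_algebra.
From mathcomp Require Import all_classical all_reals all_analysis.

Set Implicit Arguments.
Unset Strict Implicit.
Unset Printing Implicit Defensive.

Import Order.TTheory GRing.Theory Num.Theory.
Import numFieldNormedType.Exports.

Local Open Scope classical_set_scope.
Local Open Scope ring_scope.

Section hausdorff_dimension.
Context {R : realType}.
Implicit Types (A U : set R) (s delta : R).

(* [ereal_sup set0] is -oo, hence [diam set0 = -oo]; [diam_pow] below never
   uses this value. *)
Definition diam U : \bar R :=
  ereal_sup [set (`|p.1 - p.2|)%:E | p in U `*` U].

(* |U|^s, with the usual conventions: 0 for the empty set whatever s is, and
   0^0 = 1 (so that the measure of exponent 0 is the counting measure). *)
Definition diam_pow s U : \bar R :=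
  if U == set0 then 0%E else poweR (diam U) s.

Definition hausdorff_premeasure s delta A : \bar R :=
  ereal_inf [set (\sum_(0 <= k <oo) diam_pow s (U k))%E | U in
    [set U : nat -> set R |
      A `<=` \bigcup_k U k /\ forall k, (diam (U k) <= delta%:E)%E]].

(* The premeasure is nonincreasing in delta, so the supremum is the limit as
   delta tends to 0. *)
Definition hausdorff_measure s A : \bar R :=
  ereal_sup [set hausdorff_premeasure s delta A | delta in [set d | 0 < d]].

Definition hausdorff_dim A : \bar R :=
  ereal_inf [set s%:E | s in [set s | 0 <= s /\ hausdorff_measure s A = 0%E]].

End hausdorff_dimension.

Section markov_map.
Context {R : realType}.
Implicit Types (tau x : R) (k : nat) (theta : R -> R).

(* The branches are indexed by k >= 1. *)
Definition branch tau k : set R := `]tau ^+ k, tau ^+ k.-1]%classic.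

Definition branch_index tau x : nat :=
  xget 1%N [set k | (0 < k)%N /\ branch tau k x].

(* Only the values on [0, 1] are meaningful. *)
Definition markov_map tau x : R :=
  if x == 0 then 0 else
  let k := branch_index tau x in
  (tau ^+ k.-1 - x) / (tau ^+ k.-1 * (1 - tau)).

Lemma branch_inj tau k l x : 0 < tau < 1 -> (0 < k)%N -> (0 < l)%N ->
  branch tau k x -> branch tau l x -> k = l.
Proof.
move=> /andP[t0 t1].
suff H m n : (0 < n)%N -> branch tau m x -> branch tau n x -> (n <= m)%N.
  move=> k0 l0 kx lx; apply/eqP; rewrite eqn_leq.
  by rewrite (H _ _ k0 lx kx) (H _ _ l0 kx lx).
move=> n0; rewrite /branch /= !in_itv /= => /andP[mx _] /andP[_ xn].
have := lt_le_trans mx xn.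
by rewrite ltr_iXn2l//; case: n n0 {xn}.
Qed.

Lemma markov_map0 tau : markov_map tau 0 = 0.
Proof. by rewrite /markov_map eqxx. Qed.

Lemma markov_map_branch tau k x : 0 < tau < 1 -> (0 < k)%N -> branch tau k x ->
  markov_map tau x = (tau ^+ k.-1 - x) / (tau ^+ k.-1 * (1 - tau)).
Proof.
move=> t01 k0 kx; have /andP[t0 t1] := t01.
have x0 : 0 < x.
  move: kx; rewrite /branch /= in_itv /= => /andP[+ _].
  by apply: lt_trans; rewrite exprn_gt0.
rewrite /markov_map gt_eqF//.
suff -> : branch_index tau x = k by [].
rewrite /branch_index; case: xgetP => [l _ [l0 lx]|/(_ k)]; last by case.
exact: branch_inj t01 l0 k0 lx kx.
Qed.

Definition increasing_homeo01 theta : Prop :=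
  [/\ set_fun `[0, 1] `[0, 1] theta,
      {in `[0, 1] &, {homo theta : x y / x < y}},
      {within `[0, 1], continuous theta} &
      exists g : R -> R,
        [/\ set_fun `[0, 1] `[0, 1] g,
            {within `[0, 1], continuous g},
            {in `[0, 1], cancel theta g} &
            {in `[0, 1], cancel g theta}]].

Definition is_conjugacy tau tau' theta : Prop :=
  [/\ increasing_homeo01 theta,
      {in `[0, 1], forall x,
        theta (markov_map tau x) = markov_map tau' (theta x)} &
      forall k, (0 < k)%N -> theta @` branch tau k = branch tau' k].

(* The limit of the difference quotient is taken along the points of D other
   than x; at the end points of an interval this is the one-sided derivative. *)
Definition has_derivative_within (D : set R) (f : R -> R) (x l : R) : Prop :=
  (f y - f x) / (y - x) @[y --> within D (dnbhs x)] --> l.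

(* The derivative being infinite or not existing counts as nonzero. *)
Definition derivative_neq0 theta : set R :=
  [set x | x \in `[0, 1] /\ ~ has_derivative_within `[0, 1] theta x 0].

Definition p_weight (tau tau' : R) : R :=
  (ln (1 - tau') - ln (1 - tau)) /
  (ln tau - ln (1 - tau) - ln tau' + ln (1 - tau')).

End markov_map.

(* Main.v *)
(** Both maps are induced by skewed tent maps, so the conjugacy satisfies
    theta (tau x) = tau' theta x and
    theta (1 - (1 - tau) x) = 1 - (1 - tau') theta x.  A word w in the two
    inverse branches gives a cylinder I of length |I| whose image has length
    |theta I|, both products of letter weights.

    The weight p is the frequency at which log |theta I| - log |I| has no
    drift.  The Bernoulli weights (p, 1 - p) have the form
    |I|^d (|theta I| / |I|)^t with d the claimed dimension, and t >= 0 by Gibbs'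
    inequality.  If theta' x is not 0 then x lies in arbitrarily small cylinders
    with |theta I| >= c |I|, for which |I|^d is at most a constant times the
    Bernoulli weight; since these weights sum to 1 over each generation, the
    dimension is at most d.

    For the lower bound, fix a frequency close to p on the side where
    |theta I| >= |I|, and consider the sequences of blocks of this exact
    frequency.  By the mode of the binomial distribution there are about
    exp (n H) blocks of length n, and reading the base M digits of a number in
    [0, 1) as blocks is the inverse of a Hoelder map, so that the Lebesgue measure
    bounds the Hausdorff measure from below. *)

Require Import Defs.
From mathcomp Require Import all_boot all_order all_algebra.
From mathcomp Require Import all_classical all_reals all_analysis.
From mathcomp Require Import ring lra zify.
Import Order.TTheory GRing.Theory Num.Theory.
Import numFieldNormedType.Exports.
Local Open Scope classical_set_scope.
Local Open Scope ring_scope.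

(** * Cylinders of the tent maps *)

Section words.
Context {R : realType}.
Implicit Types (a x y : R) (b : bool) (w : seq bool).

(* Inverse branches of the skewed tent map; [true] is the branch onto [0, a]. *)
Definition tent_inv a b x : R := if b then a * x else 1 - (1 - a) * x.

Definition letter_wt a b : R := if b then a else 1 - a.

(** The first letter is applied last, so a prefix of a word gives a larger cylinder. *)
Definition word_map a w x : R := foldr (tent_inv a) x w.

Definition word_wt a w : R := \prod_(b <- w) letter_wt a b.

Lemma word_map_cat a w1 w2 x :
  word_map a (w1 ++ w2) x = word_map a w1 (word_map a w2 x).
Proof. exact: foldr_cat. Qed.

Lemma word_wt_cons a b w : word_wt a (b :: w) = letter_wt a b * word_wt a w.
Proof. by rewrite /word_wt big_cons. Qed.

Lemma word_wt_cat a w1 w2 : word_wt a (w1 ++ w2) = word_wt a w1 * word_wt a w2.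
Proof. by rewrite /word_wt big_cat. Qed.

Lemma word_wt_nil a : word_wt a [::] = 1.
Proof. by rewrite /word_wt big_nil. Qed.

Lemma divr_itv01 (x y : R) : 0 < y -> 0 <= x <= y -> 0 <= x / y <= 1.
Proof.
by move=> y0 /andP[x0 xy]; rewrite divr_ge0 ?(ltW y0)//= ler_pdivrMr ?mul1r.
Qed.

Lemma exists_expr_lt (r e : R) : 0 < r < 1 -> 0 < e -> exists n, r ^+ n < e.
Proof.
move=> /andP[r0 r1] e0; have : r ^+ n @[n --> \oo] --> (0 : R).
  by apply: cvg_expr; rewrite ger0_norm// ltW.
move/cvgrPdist_lt => /(_ _ e0)[n _ /(_ n (leqnn n))].
by rewrite /= sub0r normrN ger0_norm ?exprn_ge0 ?ltW// => ?; exists n.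
Qed.

Lemma letter_wt_gt0 a b : 0 < a < 1 -> 0 < letter_wt a b.
Proof. by case: b => /=; lra. Qed.

Lemma letter_wt_lt1 a b : 0 < a < 1 -> letter_wt a b < 1.
Proof. by case: b => /=; lra. Qed.

Lemma word_wt_gt0 a w : 0 < a < 1 -> 0 < word_wt a w.
Proof. by move=> a01; apply: prodr_gt0 => b _; exact: letter_wt_gt0. Qed.

Lemma word_wt_le1 a w : 0 < a < 1 -> word_wt a w <= 1.
Proof.
move=> a01; elim: w => [|b w IHw]; first by rewrite word_wt_nil.
rewrite word_wt_cons mulr_ile1// ltW//; [|exact: word_wt_gt0|].
  exact: letter_wt_gt0.
exact: letter_wt_lt1.
Qed.

Lemma tent_inv01 a b x : 0 < a < 1 -> 0 <= x <= 1 -> 0 <= tent_inv a b x <= 1.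
Proof. by case: b => /= /andP[? ?] /andP[? ?]; apply/andP; split; nra. Qed.

Lemma word_map01 a w x : 0 < a < 1 -> 0 <= x <= 1 -> 0 <= word_map a w x <= 1.
Proof. by move=> a01 x01; elim: w => //= b w; exact: tent_inv01. Qed.

Lemma tent_inv_dist a b x y : 0 < a < 1 ->
  `|tent_inv a b x - tent_inv a b y| = letter_wt a b * `|x - y|.
Proof.
move=> a01; rewrite -[letter_wt a b in RHS]gtr0_norm ?letter_wt_gt0// -normrM.
case: b => /=; first by rewrite mulrBr.
by rewrite -normrN; congr (`| _ |); ring.
Qed.

Lemma word_map_dist a w x y : 0 < a < 1 ->
  `|word_map a w x - word_map a w y| = word_wt a w * `|x - y|.
Proof.
move=> a01; elim: w => /= [|b w IHw]; first by rewrite word_wt_nil mul1r.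
by rewrite tent_inv_dist// IHw word_wt_cons mulrA.
Qed.

Lemma word_wt_nseq a n : word_wt a (nseq n true) = a ^+ n.
Proof.
by elim: n => [|n IHn] /=; rewrite ?word_wt_nil ?word_wt_cons ?IHn ?exprS.
Qed.

Lemma word_map_nseq a n x : word_map a (nseq n true) x = a ^+ n * x.
Proof. by elim: n => [|n IHn] /=; rewrite ?mul1r// IHn exprS mulrA. Qed.

End words.

Section word_wt_decay.
Context {R : realType} (a : R).
Hypothesis a01 : 0 < a < 1.

Lemma word_wt_le w : word_wt a w <= Num.max a (1 - a) ^+ size w.
Proof.
elim: w => [|b w IHw]; first by rewrite word_wt_nil.
have h : letter_wt a b <= Num.max a (1 - a).
  by rewrite le_max; case: b; rewrite lexx ?orbT.
rewrite word_wt_cons exprS ler_pM// ltW ?word_wt_gt0//.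
exact: letter_wt_gt0.
Qed.

Lemma word_wt_ge w : Num.min a (1 - a) ^+ size w <= word_wt a w.
Proof.
have m0 : 0 <= Num.min a (1 - a).
  by rewrite le_min; case/andP: a01 => *; apply/andP; split; lra.
elim: w => [|b w IHw]; first by rewrite word_wt_nil.
have h : Num.min a (1 - a) <= letter_wt a b.
  by rewrite ge_min; case: b; rewrite lexx ?orbT.
by rewrite word_wt_cons exprS ler_pM// exprn_ge0.
Qed.

Lemma max_letter01 : 0 < Num.max a (1 - a) < 1.
Proof.
by have /andP[a0 a1] := a01; rewrite lt_max gt_max a0 a1 ltrBlDr ltrDl a0.
Qed.

Lemma min_letter01 : 0 < Num.min a (1 - a) < 1.
Proof.
by have /andP[a0 a1] := a01; rewrite lt_min gt_min a0 a1 subr_gt0 a1.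
Qed.

End word_wt_decay.

(** * Lengths of the cylinders on the two sides of the cut point *)

Section split_point.
Context {R : realType} (t : R).
Hypothesis t01 : 0 < t < 1.

(** [t * (1 - t)] and [(1 - t) ^+ 2] are the lengths of the cylinders of the words 0 1 and 1 1,
    which meet at [t]; [t * (1 - t) ^+ 2] serves as a common lower bound. *)
Lemma split_coef :
  [/\ 0 <= t * (1 - t) <= 1, 0 <= (1 - t) ^+ 2 <= 1 &
      0 <= t * (1 - t) ^+ 2 <= t * (1 - t) /\
      0 <= t * (1 - t) ^+ 2 <= (1 - t) ^+ 2].
Proof.
have /andP[/ltW t0 /ltW t1] := t01.
have [s0 s1] : 0 <= 1 - t /\ 1 - t <= 1 by lra.
have e0 : 0 <= (1 - t) ^+ 2 by exact: sqr_ge0.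
split; first by rewrite mulr_ge0 ?mulr_ile1.
  by rewrite e0 exprn_ile1.
by rewrite mulr_ge0//= ler_wpM2l ?ler_piMl// expr2 ler_piMl.
Qed.

Lemma split_sum01 (u v : R) : 0 <= u <= 1 -> 0 <= v <= 1 ->
  0 <= t * (1 - t) * u + (1 - t) ^+ 2 * v <= 1.
Proof.
move=> /andP[u0 u1] /andP[v0 v1]; have /andP[t0 t1] := t01.
have [/andP[h0 _] /andP[h2 _] _] := split_coef.
have p0 : 0 <= t * (1 - t) * u by rewrite mulr_ge0.
have q0 : 0 <= (1 - t) ^+ 2 * v by rewrite mulr_ge0.
rewrite addr_ge0//=.
apply: (@le_trans _ _ (t * (1 - t) + (1 - t) ^+ 2)).
  by rewrite lerD// ler_piMr.
by clear - t0 t1; rewrite expr2; nra.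
Qed.

Lemma split_sum_ge (u v : R) : 0 <= u <= 1 -> 0 <= v <= 1 -> t < u + v ->
  t ^+ 2 * (1 - t) ^+ 2 <= t * (1 - t) * u + (1 - t) ^+ 2 * v.
Proof.
move=> /andP[u0 u1] /andP[v0 v1] tuv; have /andP[t0 t1] := t01.
have [_ _ [/andP[h0 h1] /andP[_ h2]]] := split_coef.
apply: (@le_trans _ _ (t * (1 - t) ^+ 2 * (u + v))).
  have -> : t ^+ 2 * (1 - t) ^+ 2 = t * (1 - t) ^+ 2 * t by ring.
  by rewrite ler_wpM2l// ltW.
by rewrite mulrDr lerD// ler_wpM2r.
Qed.

End split_point.
Arguments split_coef {R t}.
Arguments split_sum01 {R t} _ {u v}.

Section conjugacy.
Context {R : realType} (tau tau' : R) (theta : R -> R).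
Hypotheses (tau01 : 0 < tau < 1) (tau'01 : 0 < tau' < 1).
Hypothesis theta01 : forall x, 0 <= x <= 1 -> 0 <= theta x <= 1.
Hypothesis theta_tent_inv : forall b x, 0 <= x <= 1 ->
  theta (tent_inv tau b x) = tent_inv tau' b (theta x).

Lemma theta_word_map w x : 0 <= x <= 1 ->
  theta (word_map tau w x) = word_map tau' w (theta x).
Proof.
move=> x01; elim: w => //= b w IHw.
by rewrite theta_tent_inv ?IHw//; exact: word_map01.
Qed.

Lemma theta_0 : theta 0 = 0.
Proof.
have := theta_tent_inv true 0; rewrite /= mulr0 => /(_ _)/eqP.
rewrite lexx ler01 => /(_ isT).
rewrite -subr_eq0 -{1}[theta 0]mul1r -mulrBl mulf_eq0 => /orP[|/eqP//].
by case/andP: tau'01 => *; lra.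
Qed.

Lemma theta_1 : theta 1 = 1.
Proof.
have := theta_tent_inv false 0; rewrite /= mulr0 subr0 theta_0 mulr0 subr0.
by apply; rewrite lexx ler01.
Qed.

(** Dividing both numbers by [tau] while their sum is at most [tau] keeps them in [0, 1]; an
    exponent n with [tau ^+ n < x + y] bounds the number of divisions. *)
Lemma rescale_pair (x y : R) : 0 <= x <= 1 -> 0 <= y <= 1 -> 0 < x + y ->
  exists K x0 y0, [/\ 0 <= x0 <= 1, 0 <= y0 <= 1, tau < x0 + y0,
    x = tau ^+ K * x0 & y = tau ^+ K * y0].
Proof.
move=> x01 y01 xy0.
have [n] := exists_expr_lt _ _ tau01 xy0.
elim: n x y x01 y01 {xy0} => [|n IHn] x y /andP[x0 x1] /andP[y0 y1] xyn.
  exists 0%N, x, y; rewrite x0 x1 y0 y1 !expr0 !mul1r; split => //.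
  by move: xyn tau01; rewrite expr0 => ? /andP[]; lra.
have /andP[t0 t1] := tau01.
have [xyt|txy] := leP (x + y) tau; last first.
  by exists 0%N, x, y; rewrite x0 x1 y0 y1 !expr0 !mul1r.
have [|||K [x' [y' [x'01 y'01 tx'y' xE yE]]]] := IHn (x / tau) (y / tau).
- by apply: divr_itv01 => //; lra.
- by apply: divr_itv01 => //; lra.
- by rewrite -mulrDl ltr_pdivlMr// -exprSr.
exists K.+1, x', y'; split => //.
  by rewrite exprS -mulrA -xE mulrCA divff ?mulr1 ?gt_eqF.
by rewrite exprS -mulrA -yE mulrCA divff ?mulr1 ?gt_eqF.
Qed.

(** Each point lies in a cylinder I that is short compared with |x - y| while theta I is long
    compared with |theta x - theta y|. So |theta I| / |I| is at least a constant times the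
    difference quotient, which turns information on the derivative into information on words. *)
Definition commensurable (x y : R) := exists w w' u u',
  [/\ 0 <= u <= 1, 0 <= u' <= 1, x = word_map tau w u & y = word_map tau w' u'] /\
  [/\ tau ^+ 2 * (1 - tau) ^+ 2 * word_wt tau w <= `|x - y|,
      tau ^+ 2 * (1 - tau) ^+ 2 * word_wt tau w' <= `|x - y|,
      tau' * (1 - tau') ^+ 2 * `|theta x - theta y| <= word_wt tau' w &
      tau' * (1 - tau') ^+ 2 * `|theta x - theta y| <= word_wt tau' w'].

Lemma commensurable_sym x y : commensurable x y -> commensurable y x.
Proof.
move=> [w [w' [u [u' [[? ? ? ?] [? ? ? ?]]]]]].
by exists w', w, u', u; split; rewrite // distrC (distrC (theta y)).
Qed.

Lemma commensurable_far x y : 0 <= x <= 1 -> 0 <= y <= 1 ->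
  tau ^+ 2 * (1 - tau) ^+ 2 <= `|x - y| -> commensurable x y.
Proof.
move=> x01 y01 xy; exists [::], [::], x, y; split => //.
rewrite !word_wt_nil !mulr1.
suff : tau' * (1 - tau') ^+ 2 * `|theta x - theta y| <= 1 by [].
have /andP[? ?] := tau'01.
have := theta01 _ x01; have := theta01 _ y01; move=> /andP[? ?] /andP[? ?].
have : `|theta x - theta y| <= 1 by rewrite ler_norml; lra.
have e0 : 0 <= (1 - tau') ^+ 2 <= 1 by rewrite exprn_ge0 ?exprn_ile1//=; lra.
have e'0 : 0 <= tau' * (1 - tau') ^+ 2 <= 1.
  by rewrite mulr_ge0 ?mulr_ile1//; lra.
by move=> ?; rewrite mulr_ile1//; lra.
Qed.

(* On the two sides of tau, the cylinders of the words 0 1 0^K and 1 1 0^K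
   (0 for [true]) that abut on it have comparable lengths. *)
Lemma commensurable_straddle x y :
  0 <= x <= tau -> tau <= y <= 1 -> x < y -> commensurable x y.
Proof.
move=> /andP[x0 xt] /andP[ty y1] xy; have /andP[t0 t1] := tau01.
have xyE : `|x - y| = y - x by rewrite ltr0_norm; lra.
have s0 : 0 < (1 - tau) ^+ 2 by rewrite exprn_gt0; lra.
have s1 : (1 - tau) ^+ 2 < 1 - tau by rewrite expr2; nra.
have st : tau ^+ 2 < tau by rewrite expr2; nra.
have t2 : 0 < tau ^+ 2 by rewrite exprn_gt0.
(* The words 0 1 and 1 1 have the cylinders [tau^2, tau] and [tau, tau + (1 - tau)^2]. If x or y is
   outside its cylinder, the distance is bounded below and the empty word will do. *)
have [xl|xl] := ltP x (tau ^+ 2).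
  apply: commensurable_far; [lra|lra|rewrite xyE]; nra.
have [yl|yl] := ltP (tau + (1 - tau) ^+ 2) y.
  apply: commensurable_far; [lra|lra|rewrite xyE]; nra.
(* [a] and [c] are the coordinates of x and y in these cylinders, both vanishing at [tau]. Appending
   0^K zooms in on [tau] by the same factor tau^K on both sides. *)
pose a := (tau - x) / (tau * (1 - tau)); pose c := (y - tau) / (1 - tau) ^+ 2.
have tt0 : 0 < tau * (1 - tau) by rewrite mulr_gt0// subr_gt0.
have aE : a * (tau * (1 - tau)) = tau - x by rewrite divfK// gt_eqF.
have cE : c * (1 - tau) ^+ 2 = y - tau by rewrite divfK// gt_eqF.
have a01 : 0 <= a <= 1.
  by apply: divr_itv01 => //; lra.
have c01 : 0 <= c <= 1.
  by apply: divr_itv01 => //; lra.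
have ac0 : 0 < a + c by move: a01 c01 => /andP[? ?] /andP[? ?]; nra.
have [K [a0 [c0 [a001 c001 ac aK cK]]]] := rescale_pair _ _ a01 c01 ac0.
have xE : x = word_map tau ([:: true; false] ++ nseq K true) a0.
  by rewrite word_map_cat word_map_nseq -aK /=; lra.
have yE : y = word_map tau ([:: false; false] ++ nseq K true) c0.
  by rewrite word_map_cat word_map_nseq -cK /=; lra.
exists ([:: true; false] ++ nseq K true), ([:: false; false] ++ nseq K true), a0, c0.
split=> //.
have w1E z : word_wt z ([:: true; false] ++ nseq K true) = z * (1 - z) * z ^+ K.
  by rewrite word_wt_cat word_wt_nseq !word_wt_cons word_wt_nil /= mulr1.
have w2E z : word_wt z ([:: false; false] ++ nseq K true) = (1 - z) ^+ 2 * z ^+ K.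
  by rewrite word_wt_cat word_wt_nseq !word_wt_cons word_wt_nil /= mulr1 expr2.
have dE : y - x = tau ^+ K * (tau * (1 - tau) * a0 + (1 - tau) ^+ 2 * c0).
  transitivity (a * (tau * (1 - tau)) + c * (1 - tau) ^+ 2); first lra.
  by rewrite aK cK; ring.
have thE : theta y - theta x =
  tau' ^+ K * (tau' * (1 - tau') * theta a0 + (1 - tau') ^+ 2 * theta c0).
  rewrite xE yE !theta_word_map// !word_map_cat !word_map_nseq /=; ring.
have k0 : 0 < tau ^+ K by rewrite exprn_gt0.
have k'0 : 0 <= tau' ^+ K by rewrite exprn_ge0// ltW//; case/andP: tau'01.
have thN : `|theta x - theta y| <= tau' ^+ K.
  rewrite distrC thE normrM ger0_norm//.
  have /andP[? ?] := split_sum01 tau'01 (theta01 _ a001) (theta01 _ c001).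
  by rewrite ger0_norm// ler_piMr.
have d1 : tau ^+ K * (tau ^+ 2 * (1 - tau) ^+ 2) <= y - x.
  rewrite dE ler_pM2l//; exact: split_sum_ge.
have e0 : 0 <= tau ^+ 2 * (1 - tau) ^+ 2 by rewrite mulr_ge0 ?sqr_ge0.
have aux z (v : R) : 0 <= v <= 1 -> z = v * tau ^+ K ->
    tau ^+ 2 * (1 - tau) ^+ 2 * z <= y - x.
  move=> /andP[v0 v1] ->; apply: le_trans d1.
  by rewrite mulrC ler_wpM2r// ler_piMl// ltW.
have aux' z : 0 <= tau' * (1 - tau') ^+ 2 <= z ->
    tau' * (1 - tau') ^+ 2 * `|theta x - theta y| <= z * tau' ^+ K.
  by move=> /andP[? ?]; rewrite ler_pM.
have [h1 h2 _] := split_coef tau01; have [_ _ [h3 h4]] := split_coef tau'01.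
by rewrite !w1E !w2E xyE; split;
  [exact: aux h1 _|exact: aux h2 _|exact: aux' h3|exact: aux' h4].
Qed.

Lemma commensurable_tent_inv b x y : 0 <= x <= 1 -> 0 <= y <= 1 ->
  commensurable x y -> commensurable (tent_inv tau b x) (tent_inv tau b y).
Proof.
move=> x01 y01 [w [w' [u [u' [[u01 u'01 xE yE] [e1 e2 e3 e4]]]]]].
exists (b :: w), (b :: w'), u, u'; split; first by rewrite /= -xE -yE.
have l0 := letter_wt_gt0 tau b tau01; have l'0 := letter_wt_gt0 tau' b tau'01.
rewrite !theta_tent_inv// !word_wt_cons !tent_inv_dist//.
by split; rewrite mulrCA ler_pM2l.
Qed.

(** While both points are on the same side of [tau], undoing one letter moves them apart by a factor
    of at least 1 / r. In [0, 1] this can happen only finitely often, after which they straddle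
    [tau]. *)
Lemma commensurable_ne x y : 0 <= x <= 1 -> 0 <= y <= 1 -> x != y ->
  commensurable x y.
Proof.
have /andP[t0 t1] := tau01.
pose r := Num.max tau (1 - tau).
have r01 : 0 < r < 1 := max_letter01 _ tau01.
have lr b : letter_wt tau b <= r.
  by rewrite /r; case: b => /=; rewrite le_max lexx ?orbT.
move=> + + xy; have [n] : exists n, r ^+ n < `|x - y|.
  by apply: exists_expr_lt; rewrite // normr_gt0 subr_eq0.
elim: n x y {xy} => [|n IHn] x y.
  rewrite expr0 => h /andP[? ?] /andP[? ?]; exfalso.
  by move: h; apply/negP; rewrite -leNgt ler_norml; lra.
wlog xy : x y / x <= y => [hwlog|].
  have [xy|xy] := leP x y; first exact: hwlog.
  rewrite distrC => ? ? ?; apply: commensurable_sym.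
  by apply: hwlog => //; exact: ltW.
move=> rxy x01 y01.
have zoom b x' y' : 0 <= x' <= 1 -> 0 <= y' <= 1 ->
    x = tent_inv tau b x' -> y = tent_inv tau b y' -> commensurable x y.
  move=> x'01 y'01 xE yE; rewrite xE yE; apply: commensurable_tent_inv => //.
  apply: IHn => //; move: rxy; rewrite xE yE tent_inv_dist// exprS => rxy.
  have r0 : 0 < r by case/andP: r01.
  rewrite -(ltr_pM2l r0); apply: lt_le_trans rxy _.
  by rewrite ler_wpM2r.
move: x01 y01 => /andP[x0 x1] /andP[y0 y1].
have [yt|ty] := leP y tau.
  apply: (zoom true (x / tau) (y / tau)) => /=.
  - by apply: divr_itv01 => //; lra.
  - by apply: divr_itv01 => //; lra.
  - by field; lra.
  - by field; lra.
have [tx|xt] := leP tau x.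
  have t1' : 0 < 1 - tau by lra.
  apply: (zoom false ((1 - x) / (1 - tau)) ((1 - y) / (1 - tau))) => /=.
  - by apply: divr_itv01 => //; lra.
  - by apply: divr_itv01 => //; lra.
  - by field; lra.
  - by field; lra.
by apply: commensurable_straddle; lra.
Qed.

End conjugacy.

(** * Entropy and the exponential tilt *)

Section entropy.
Context {R : realType}.
Implicit Types (a b p q : R).

Definition entropy p : R := - (p * ln p + (1 - p) * ln (1 - p)).

Definition cross_entropy p a : R := - (p * ln a + (1 - p) * ln (1 - a)).

Lemma ln_le_subr1 (x : R) : 0 < x -> ln x <= x - 1.
Proof.
move=> x0; have := @le_ln1Dx _ (x - 1); rewrite (addrC 1) subrK; apply; lra.
Qed.

Lemma ln_lt_subr1 (x : R) : 0 < x -> x != 1 -> ln x < x - 1.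
Proof.
move=> x0 x1; rewrite -ltr_expR lnK ?posrE//.
by have := @expR_gt1Dx _ (x - 1); rewrite (addrC 1) subrK subr_eq0; exact.
Qed.

(** The bound ln x <= x - 1 at the ratios a / p and (1 - a) / (1 - p), averaged with weights p and 1
    - p; it is strict at the first ratio, which is not 1. *)
Lemma gibbs_lt p a : 0 < p < 1 -> 0 < a < 1 -> p != a ->
  entropy p < cross_entropy p a.
Proof.
move=> /andP[p0 p1] /andP[a0 a1] pa.
have q0 : 0 < 1 - p by lra. have b0 : 0 < 1 - a by lra.
have h1 : ln a - ln p < a / p - 1.
  rewrite -ln_div ?posrE//; apply: ln_lt_subr1; first exact: divr_gt0.
  by apply: contra_neq pa => /(congr1 ( *%R^~ p)); rewrite divfK ?gt_eqF// mul1r.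
have h2 : ln (1 - a) - ln (1 - p) <= (1 - a) / (1 - p) - 1.
  by rewrite -ln_div ?posrE//; apply: ln_le_subr1; exact: divr_gt0.
have k1 : p * (ln a - ln p) < a - p.
  move: h1; rewrite -(ltr_pM2l p0) [X in _ < X]mulrBr mulr1 mulrCA.
  by rewrite divff ?mulr1 ?gt_eqF.
have k2 : (1 - p) * (ln (1 - a) - ln (1 - p)) <= p - a.
  move: h2; rewrite -(ler_pM2l q0) [X in _ <= X]mulrBr mulr1 mulrCA divff ?gt_eqF//.
  lra.
rewrite /entropy /cross_entropy; lra.
Qed.

Lemma gibbs_le p a : 0 < p < 1 -> 0 < a < 1 -> entropy p <= cross_entropy p a.
Proof.
move=> p01 a01; have [->//|pa] := eqVneq p a.
by apply: ltW; exact: gibbs_lt.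
Qed.

Lemma cross_entropy_gt0 p a : 0 < p < 1 -> 0 < a < 1 -> 0 < cross_entropy p a.
Proof.
move=> /andP[p0 p1] a01; have /andP[a0 a1] := a01.
have h1 : ln a < 0 by rewrite ln_lt0.
have h2 : ln (1 - a) < 0 by rewrite ln_lt0//; lra.
by rewrite /cross_entropy; nra.
Qed.

End entropy.

(** * The driftless frequency and its exponential tilt *)

Section p_weight.
Context {R : realType} (tau tau' : R).
Hypotheses (tau01 : 0 < tau < 1) (tau'01 : 0 < tau' < 1).
Hypothesis (neq_tau : tau != tau').
Local Notation p := (p_weight tau tau').

(** The mean of log |theta I| - log |I| per letter, for words in which [true] has frequency q. *)
Definition drift q : R := cross_entropy q tau - cross_entropy q tau'.

Let slope : R := ln tau' - ln tau - ln (1 - tau') + ln (1 - tau).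

Lemma drift_target : 0 < drift tau'.
Proof. by rewrite subr_gt0; apply: gibbs_lt; rewrite // eq_sym. Qed.

Lemma drift_source : drift tau < 0.
Proof. by rewrite subr_lt0; exact: gibbs_lt. Qed.

Lemma slope_neq0 : slope != 0.
Proof.
apply/eqP => s0; have := drift_target; have := drift_source.
suff -> : drift tau' = drift tau + (tau' - tau) * slope by rewrite s0; lra.
by rewrite /drift /slope /cross_entropy; ring.
Qed.

Lemma driftE q : drift q = (q - p) * slope.
Proof.
have := slope_neq0; rewrite /drift /p_weight /slope /cross_entropy.
by move=> s0; field; apply: contra_neq s0; lra.
Qed.

Lemma drift_p : drift p = 0.
Proof. by rewrite driftE subrr mul0r. Qed.

(** By Gibbs' inequality the drift is negative at [tau] and positive at [tau']; it is affine in the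
    frequency with zero p. *)
Lemma p_between : tau < p < tau' \/ tau' < p < tau.
Proof.
have := drift_source; have := drift_target; rewrite !driftE.
have [s0|s0|s0] := ltgtP 0 slope.
- by rewrite pmulr_lgt0// pmulr_llt0// => *; left; lra.
- by rewrite nmulr_lgt0// nmulr_llt0// => *; right; lra.
- by have := slope_neq0; rewrite -s0 eqxx.
Qed.

Lemma p_weight01 : 0 < p < 1.
Proof.
by case: p_between => /andP[? ?]; move: tau01 tau'01 => /andP[? ?] /andP[? ?];
  apply/andP; split; lra.
Qed.

Definition conj_dim : R := entropy p / cross_entropy p tau.

Lemma conj_dimE : entropy p = conj_dim * cross_entropy p tau.
Proof. by rewrite divfK// gt_eqF// cross_entropy_gt0// p_weight01. Qed.

Lemma conj_dim_le1 : conj_dim <= 1.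
Proof.
by rewrite ler_pdivrMr ?mul1r ?gibbs_le ?cross_entropy_gt0 ?p_weight01.
Qed.

(* The weights (p, 1 - p) are an exponential tilt of the lengths: this is the
   stationarity condition for the minimum of the pressure of the potentials
   d log |I| + t log (|theta I| / |I|). *)
Lemma exponential_tilt : exists2 t, 0 <= t &
  ln p = conj_dim * ln tau + t * (ln tau' - ln tau) /\
  ln (1 - p) = conj_dim * ln (1 - tau) + t * (ln (1 - tau') - ln (1 - tau)).
Proof.
have /andP[t0 t1] := tau01; have /andP[t'0 t'1] := tau'01.
have /andP[p0 p1] := p_weight01.
have A0 : ln tau' - ln tau != 0.
  rewrite subr_eq0; apply: contra_neq neq_tau => /ln_inj.
  by rewrite !posrE => ->.
pose t := (ln p - conj_dim * ln tau) / (ln tau' - ln tau).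
have e1 : ln p = conj_dim * ln tau + t * (ln tau' - ln tau).
  by rewrite /t divfK//; ring.
have e2 : ln (1 - p) = conj_dim * ln (1 - tau) + t * (ln (1 - tau') - ln (1 - tau)).
  (* The average of the two identities with weights p and 1 - p holds by [conj_dimE] and [drift_p],
     so the first identity implies the second. *)
  have q0 : 1 - p != 0 by rewrite gt_eqF ?subr_gt0.
  apply: (mulfI q0).
  have := conj_dimE; have := drift_p.
  rewrite /drift /entropy /cross_entropy => e4 e3.
  have e5 := congr1 (fun z => p * z) e1; have e6 := congr1 (fun z => t * z) e4.
  by rewrite /= in e5 e6; lra.
exists t => //.
(* With the tilt substituted, Gibbs' inequality for [tau] against p says that t * (- drift tau) is
   at least (1 - d) times the entropy of [tau], hence nonnegative; and the drift at [tau] is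
   negative. *)
have := gibbs_le _ _ tau01 p_weight01.
have key : cross_entropy tau p - entropy tau
    = t * - drift tau - (1 - conj_dim) * cross_entropy tau tau.
  rewrite /drift /cross_entropy /entropy e1 e2; ring.
move=> g; have h1 : 0 <= (1 - conj_dim) * cross_entropy tau tau.
  by rewrite mulr_ge0 ?subr_ge0 ?conj_dim_le1// ltW// cross_entropy_gt0.
have h2 : 0 <= t * - drift tau by lra.
by move: h2; rewrite pmulr_lge0// oppr_gt0 drift_source.
Qed.

Lemma ln_word_wt_tilt : exists2 t, 0 <= t & forall w,
  ln (word_wt p w) = conj_dim * ln (word_wt tau w)
    + t * (ln (word_wt tau' w) - ln (word_wt tau w)).
Proof.
have [t t0 [e1 e2]] := exponential_tilt; exists t => //.
elim=> [|b w IHw]; first by rewrite !word_wt_nil ln1; ring.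
have p01 := p_weight01.
rewrite !word_wt_cons !lnM ?posrE ?letter_wt_gt0 ?word_wt_gt0// IHw.
by case: b => /=; rewrite ?e1 ?e2; ring.
Qed.

End p_weight.

(** * Binomial coefficients and entropy *)

Section binomial_mode.
Context {R : realType} (n j : nat).
Hypotheses (j_gt0 : (0 < j)%N) (j_lt : (j < n)%N).
Let q : R := j%:R / n%:R.
Let T i : R := 'C(n, i)%:R * (q ^+ i * (1 - q) ^+ (n - i)).

Lemma freq01 : 0 < q < 1.
Proof.
have n0 : (0 : R) < n%:R by rewrite ltr0n (leq_trans _ j_lt).
have h0 : 0 < q by apply: divr_gt0; rewrite // ltr0n.
by rewrite h0 /q ltr_pdivrMr// mul1r ltr_nat.
Qed.

Let T_ge0 i : 0 <= T i.
Proof.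
have /andP[? ?] := freq01.
by rewrite !mulr_ge0// exprn_ge0//; lra.
Qed.

(** The ratio of consecutive binomial probabilities. Since (n - i) j - (i + 1) (n - j) = n (j - i -
    1) + j and j < n, they increase up to i = j and decrease afterwards. *)
Let T_step i : (i < n)%N ->
  (i.+1 * (n - j))%:R * T i.+1 = ((n - i) * j)%:R * T i.
Proof.
move=> i_lt; have n0 : (n%:R : R) != 0 by rewrite pnatr_eq0; lia.
have jE : (j%:R : R) = n%:R * q by rewrite mulrC divfK.
have mE : ((n - j)%:R : R) = n%:R * (1 - q) by rewrite natrB ?(ltnW j_lt)// jE; ring.
have := congr1 (fun k : nat => k%:R : R) (mul_bin_left n i); rewrite /= !natrM => bE.
rewrite /T mE jE.
have -> : (n - i = (n - i.+1).+1)%N by lia.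
transitivity ((i.+1%:R * 'C(n, i.+1)%:R) *
  (n%:R * (1 - q) * (q ^+ i.+1 * (1 - q) ^+ (n - i.+1)))).
  by ring.
rewrite bE [(n - i)%:R](_ : _ = (n - i.+1).+1%:R); last by congr _%:R; lia.
by rewrite !exprS; ring.
Qed.

Let T_up i : (i < j)%N -> T i <= T i.+1.
Proof.
move=> ij; have i_lt : (i < n)%N by lia.
have c0 : (0 : R) < (i.+1 * (n - j))%:R by rewrite ltr0n muln_gt0 subn_gt0.
by rewrite -(ler_pM2l c0) T_step// ler_wpM2r ?T_ge0// ler_nat mulnC leq_mul; lia.
Qed.

Let T_down i : (j <= i < n)%N -> T i.+1 <= T i.
Proof.
move=> /andP[ij i_lt].
have c0 : (0 : R) < (i.+1 * (n - j))%:R by rewrite ltr0n muln_gt0 subn_gt0.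
by rewrite -(ler_pM2l c0) T_step// ler_wpM2r ?T_ge0// ler_nat mulnC leq_mul; lia.
Qed.

Let T_mode i : (i <= n)%N -> T i <= T j.
Proof.
move=> i_le; have [ij|ji] := leqP i j.
  rewrite -(subKn ij); elim: (j - i)%N (leq_subr i j) => [|k IHk] kj.
    by rewrite subn0.
  apply: le_trans (IHk (ltnW kj)).
  by rewrite [X in _ <= T X](_ : _ = (j - k.+1).+1)%N; [apply: T_up|]; lia.
rewrite -(subnKC (ltnW ji)).
have : (j + (i - j) <= n)%N by lia.
elim: (i - j)%N => [|k IHk] kj; first by rewrite addn0.
rewrite addnS; apply: le_trans (IHk _); last lia.
by apply: T_down; lia.
Qed.

(** The n + 1 probabilities sum to 1 and the one at j is the largest, so it is at least 1 / (n + 1);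
    a single word of this type has probability exp (- n H(q)). *)
Lemma binomial_entropy_ge :
  expR (n%:R * entropy q) <= n.+1%:R * 'C(n, j)%:R :> R.
Proof.
have /andP[q0 q1] := freq01; have r0 : 0 < 1 - q by lra.
have sumT : \sum_(i < n.+1) T i = 1.
  have := exprDn (1 - q) q n; rewrite subrK expr1n => ->.
  by apply: eq_bigr => i _; rewrite /T mulr_natl mulrC.
have h : 1 <= n.+1%:R * T j.
  rewrite -[X in X <= _]sumT; apply: le_trans (ler_sum _ _) _ => [i _|].
    by apply: T_mode; rewrite -ltnS.
  by rewrite sumr_const card_ord mulr_natl.
have n0 : (n%:R : R) != 0 by rewrite pnatr_eq0; lia.
have jE : (j%:R : R) = n%:R * q by rewrite mulrC divfK.
have mE : ((n - j)%:R : R) = n%:R * (1 - q) by rewrite natrB ?(ltnW j_lt)// jE; ring.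
have e : q ^+ j * (1 - q) ^+ (n - j) = expR (- (n%:R * entropy q)).
  rewrite -{1}(lnK q0) -{1}(lnK r0) -!expRM_natl -expRD jE mE.
  by congr expR; rewrite /entropy; ring.
by move: h; rewrite /T e mulrA expRN ler_pdivlMr ?mul1r ?expR_gt0.
Qed.

End binomial_mode.

(** * Blocks of exact rational frequency *)

Section block_choice.
Context {R : realType} (tau tau' : R).
Hypotheses (tau01 : 0 < tau < 1) (tau'01 : 0 < tau' < 1).
Hypothesis (neq_tau : tau != tau').
Local Notation p := (p_weight tau tau').

Definition type_wt a n j : R := a ^+ j * (1 - a) ^+ (n - j).

Lemma ln_type_wt a n j : 0 < a < 1 ->
  ln (type_wt a n j) = j%:R * ln a + (n - j)%:R * ln (1 - a).
Proof.
move=> /andP[a0 a1]; have b0 : 0 < 1 - a by lra.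
by rewrite lnM ?posrE ?exprn_gt0// !lnXn// !mulr_natl.
Qed.

Lemma type_wt_gt0 a n j : 0 < a < 1 -> 0 < type_wt a n j.
Proof. by move=> /andP[? ?]; rewrite mulr_gt0// exprn_gt0//; lra. Qed.

Lemma good_frequency s : s < conj_dim tau tau' -> exists a b : nat,
  [/\ (0 < a < b)%N, 0 < drift tau tau' (a%:R / b%:R) &
      0 < entropy (a%:R / b%:R : R) - s * cross_entropy (a%:R / b%:R) tau].
Proof.
move=> sd; have p01 := p_weight01 _ _ tau01 tau'01 neq_tau.
have /andP[p0 p1] := p01.
pose G (q : R) := entropy q - s * cross_entropy q tau.
have Gp : 0 < G p.
  rewrite /G conj_dimE// -mulrBl mulr_gt0 ?subr_gt0//.
  exact: cross_entropy_gt0.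
have Gc : {for p, continuous G}.
  have c1 : {for p, continuous (fun x : R => ln x)} by exact: continuous_ln.
  have c2 : {for p, continuous (fun x : R => ln (1 - x))}.
    apply: (@continuous_comp _ _ _ (fun x : R => 1 - x) (@ln R)).
      by apply: cvgB; [exact: cvg_cst|exact: cvg_id].
    by apply: continuous_ln; lra.
  have ci : {for p, continuous (fun x : R => x)} by exact: cvg_id.
  have cc (k : R) : {for p, continuous (fun x : R => k)} by exact: cvg_cst.
  have ce : {for p, continuous entropy}.
    exact: (cvgN (cvgD (cvgM ci c1) (cvgM (cvgB (cc 1) ci) c2))).
  have cx : {for p, continuous (cross_entropy^~ tau)}.
    exact: (cvgN (cvgD (cvgM ci (cc (ln tau)))
                       (cvgM (cvgB (cc 1) ci) (cc (ln (1 - tau)))))).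
  have cs : {for p, continuous (fun q => s * cross_entropy q tau)}.
    exact: (cvgM (cc s) cx).
  exact: (@cvgB _ _ _ (nbhs p) _ entropy (fun q => s * cross_entropy q tau)).
have : \forall q \near p, 0 < G q.
  exact: (cvgr_gt _ Gc).
move=> /nbhs_ballP[e /= e0 eG].
(* The drift is affine with zero p, so its sign follows from that at [tau']. *)
have dE q : drift tau tau' q * (tau' - p) = drift tau tau' tau' * (q - p).
  by rewrite !(driftE _ _ tau01 tau'01 neq_tau); ring.
have dt := drift_target _ _ tau01 tau'01 neq_tau.
have [x [y [xy xyP]]] : exists x y, x < y /\ forall q, x < q < y ->
    [/\ 0 < q < 1, `|p - q| < e & 0 < drift tau tau' q].
  have [/andP[tp pt']|/andP[t'p pt]] := p_between _ _ tau01 tau'01 neq_tau.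
  - exists p, (Num.min tau' (p + e)); split; first by rewrite lt_min pt' ltrDl.
    move=> q; rewrite lt_min => /and3P[pq qt' qe]; split.
      - by rewrite (lt_trans p0 pq) (lt_trans qt')//; case/andP: tau'01.
      - by rewrite ltr_norml; apply/andP; split; lra.
    have t0 : 0 < tau' - p by lra.
    by rewrite -(pmulr_lgt0 _ t0) dE mulr_gt0// subr_gt0.
  - exists (Num.max tau' (p - e)), p; split.
      by rewrite gt_max t'p ltrBlDr ltrDl.
  move=> q; rewrite gt_max => /andP[/andP[t'q qe] qp]; split.
      - by rewrite (lt_trans _ t'q) ?(lt_trans qp)//; case/andP: tau'01.
      - by rewrite ltr_norml; apply/andP; split; lra.
  have t0 : tau' - p < 0 by lra.
  by rewrite -(nmulr_llt0 _ t0) dE pmulr_rlt0// subr_lt0.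
have [r] := rat_in_itvoo xy; rewrite in_itv /= => rxy.
have [r01 re rd] := xyP _ rxy.
have r0 : 0 < r by rewrite -(@ltr0q R); case/andP: r01.
exists `|numq r|%N, `|denq r|%N.
have nE : ((`|numq r|%N)%:R : R) = (numq r)%:~R.
  by rewrite pmulrn gez0_abs// numq_ge0 ltW.
have mE : ((`|denq r|%N)%:R : R) = (denq r)%:~R.
  by rewrite pmulrn gez0_abs// denq_ge0.
have rE : (`|numq r|%N)%:R / (`|denq r|%N)%:R = ratr r :> R by rewrite nE mE.
rewrite rE; split => //; last exact: eG.
have m0 : (0 < `|denq r|)%N by rewrite absz_gt0 denq_neq0.
rewrite absz_gt0 numq_eq0 gt_eqF//=.
have : ratr r < 1 :> R by case/andP: r01.
by rewrite -rE ltr_pdivrMr ?ltr0n// mul1r ltr_nat.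
Qed.

(* The two more letters are reserved for separating the cylinders. *)
Lemma good_block s : s < conj_dim tau tau' -> 0 <= s -> exists n j : nat,
  [/\ (j <= n)%N, type_wt tau n.+2 j.+1 <= type_wt tau' n.+2 j.+1 &
      2 <= 'C(n, j)%:R * type_wt tau n.+2 j.+1 `^ s].
Proof.
move=> sd s0; have [a [b [/andP[a0 ab] d0 G0]]] := good_frequency _ sd.
set q : R := _ / _ in d0 G0.
set G : R := entropy q - s * cross_entropy q tau in G0.
have b0' : (0 < b)%N by exact: leq_trans ab.
have b0 : (0 : R) < b%:R by rewrite ltr0n.
(* [c0] and [c1] are the log-weights of the two reserved letters, one of each kind. *)
pose c0 := ln tau + ln (1 - tau); pose c1 := ln tau' + ln (1 - tau').
pose K := 2 * expR (- (s * c0)).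
have K0 : 0 < K by rewrite mulr_gt0 ?expR_gt0.
(* The first term gives (n G)^2 / 2 >= 2 K n >= K (n + 1), so that exp (n G) beats the polynomial
   loss; the second makes n times the drift outweigh [c1 - c0]. *)
pose N := (Num.truncn (4 * K / G ^+ 2) +
  Num.truncn (`|c1 - c0| / drift tau tau' q)).+1.
have bN : (N%:R : R) <= (b * N)%:R by rewrite ler_nat leq_pmull.
have N1 : 4 * K / G ^+ 2 <= (b * N)%:R.
  apply: le_trans bN; apply: ltW; apply: lt_le_trans (truncnS_gt _) _.
  by rewrite ler_nat ltnS leq_addr.
have N2 : `|c1 - c0| / drift tau tau' q <= (b * N)%:R.
  apply: le_trans bN; apply: ltW; apply: lt_le_trans (truncnS_gt _) _.
  by rewrite ler_nat ltnS leq_addl.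
have N0 : (0 < N)%N by [].
move: N N0 bN N1 N2 => N N0 bN N1 N2.
pose n := (b * N)%N; pose j := (a * N)%N.
have jn : (0 < j < n)%N by rewrite muln_gt0 a0 N0 ltn_pmul2r.
have /andP[j0 jn'] := jn.
have n1 : 1 <= n%:R :> R by rewrite ler1n (leq_trans j0)// ltnW.
have qE : j%:R / n%:R = q.
  rewrite /j /n !natrM invfM mulrACA divff ?mulr1//.
  by rewrite pnatr_eq0 -lt0n.
have jE : (j%:R : R) = n%:R * q.
  by rewrite -qE mulrC divfK// gt_eqF// (lt_le_trans _ n1).
have mE : ((n - j)%:R : R) = n%:R * (1 - q) by rewrite natrB ?(ltnW jn')// jE; ring.
have ln_blk x : 0 < x < 1 -> ln (type_wt x n.+2 j.+1)
    = - (n%:R * cross_entropy q x) + (ln x + ln (1 - x)).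
  move=> x01; rewrite ln_type_wt// subSS subSn ?(ltnW jn')//.
  by rewrite -[j.+1%:R]natr1 -[(n - j).+1%:R]natr1 jE mE /cross_entropy; ring.
exists n, j; split; first exact: ltnW.
  rewrite -ler_ln ?posrE ?type_wt_gt0// !ln_blk//.
  move: N2; rewrite ler_pdivrMr// -/n.
  have : - (c1 - c0) <= `|c1 - c0| by rewrite ler_normr lexx orbT.
  by rewrite /c1 /c0 /drift; lra.
have Cn : expR (n%:R * entropy q) <= n.+1%:R * 'C(n, j)%:R :> R.
  by rewrite -qE; exact: binomial_entropy_ge.
have n'0 : (0 : R) < n.+1%:R by rewrite ltr0n.
have wE : type_wt tau n.+2 j.+1 `^ s =
    expR (- (n%:R * (s * cross_entropy q tau)) + s * c0).
  rewrite /powR gt_eqF ?type_wt_gt0// ln_blk//; congr expR.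
  by rewrite /c0; ring.
rewrite -(ler_pM2l n'0) mulrA.
apply: le_trans (ler_wpM2r (powR_ge0 _ _) Cn); rewrite wE -expRD.
have -> : n%:R * entropy q + (- (n%:R * (s * cross_entropy q tau)) + s * c0) =
  n%:R * G + s * c0 by rewrite /G; ring.
rewrite -[s * c0]opprK expRB ler_pdivlMr ?expR_gt0// -mulrA -/K.
have nG0 : 0 <= n%:R * G by rewrite mulr_ge0 // ltW.
apply: le_trans (expR_ge1Dxn 1 nG0).
move: N1; rewrite ler_pdivrMr ?exprn_gt0// -/n => N1.
have : 4 * K * n%:R <= n%:R * G ^+ 2 * n%:R by rewrite ler_wpM2r.
rewrite -natr1 exprMn !expr2 [2`!%:R](_ : _ = 2)//.
have : K <= K * n%:R by rewrite ler_peMr// ltW.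
lra.
Qed.

End block_choice.

(** * Lower bound *)

Section hausdorff_facts.
Context {R : realType}.
Implicit Types (A U : set R) (s : R).

Lemma diam_dist U (x y : R) : U x -> U y -> (`|x - y|%:E <= diam U)%E.
Proof. by move=> Ux Uy; apply: ereal_sup_ubound; exists (x, y). Qed.

Lemma diam_pow_ge0 s U : (0 <= diam_pow s U)%E.
Proof. by rewrite /diam_pow; case: ifP => // _; exact: poweR_ge0. Qed.

Lemma diam_pow_fin U s x : U x -> (diam U <= 1%:E)%E ->
  exists2 r : R, 0 <= r & diam U = r%:E /\ diam_pow s U = (r `^ s)%:E.
Proof.
move=> Ux dU1; have := diam_dist _ _ _ Ux Ux; rewrite subrr normr0 => dU0.
exists (fine (diam U)); first exact: fine_ge0.
have dU : (diam U = (fine (diam U))%:E)%E.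
  rewrite fineK// ge0_fin_numE//; exact: le_lt_trans dU1 (ltry _).
split=> //; rewrite /diam_pow; case: eqVneq => [U0|_].
  by move: Ux; rewrite U0.
by rewrite {1}dU poweR_EFin.
Qed.

(* Mass distribution principle for the image of the Lebesgue measure on [0, 1)
   under h. *)
Lemma hausdorff_measure_neq0 A s (C : R) (h : R -> R) :
  0 <= s -> 0 < C -> (forall t : R, 0 <= t < 1 -> A (h t)) ->
  (forall t t' : R, 0 <= t < 1 -> 0 <= t' < 1 ->
    `|t - t'| <= C * `|h t - h t'| `^ s) ->
  hausdorff_measure s A <> 0%E.
Proof.
move=> s0 C0 Ah hol H0.
have C20 : 0 < 2 * C by rewrite mulr_gt0.
(* A null set has a cover with sum of |U k|^s below 1 / (2 C), the scale 1 keeping the diameters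
   finite. The part of [0, 1) sent into U k lies in an interval of length at most 2 C |U k|^s, so
   [0, 1) would be covered with total length below 1. *)
have : (hausdorff_premeasure s 1 A < ((2 * C)^-1)%:E)%E.
  apply: (@le_lt_trans _ _ 0%E); last by rewrite lte_fin invr_gt0.
  by rewrite -H0; apply: ereal_sup_ubound; exists 1 => //=.
move=> /ereal_inf_lt[_ [U [AU dU] <-] ltU].
pose V k := [set t : R | 0 <= t < 1 /\ U k (h t)].
have /choice[J JP] : forall k, exists J : set R,
    [/\ measurable J, V k `<=` J &
      (lebesgue_measure J <= (2 * C)%:E * diam_pow s (U k))%E].
  move=> k.
  have [V0|/set0P[t0 [t001 Ut0]]] := eqVneq (V k) set0.
    exists set0; split => //; first by rewrite V0.
    by rewrite measure0 mule_ge0 ?diam_pow_ge0// lee_fin ltW.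
  have [r r0 [rE rsE]] := diam_pow_fin _ s _ Ut0 (dU k).
  pose D := C * r `^ s.
  have D0 : 0 <= D by rewrite mulr_ge0 ?powR_ge0// ltW.
  exists `[t0 - D, t0 + D]%classic; split => //.
    move=> t [t01 Ut] /=; rewrite in_itv /= -ler_distlC.
    apply: le_trans (hol _ _ t001 t01) _.
    rewrite ler_pM2l// ge0_ler_powR ?nnegrE// -lee_fin -rE.
    exact: diam_dist.
  rewrite rsE lebesgue_measure_itv /=; case: ifP => _; last first.
    by rewrite -EFinM lee_fin mulr_ge0 ?powR_ge0// ltW.
  by rewrite -EFinD -EFinM lee_fin /D; lra.
have JU : `[0, 1[ `<=` \bigcup_k J k.
  move=> t /=; rewrite in_itv /= => t01.
  have [k _ Ukt] := AU _ (Ah _ t01).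
  by exists k => //; have [_ + _] := JP k; apply.
have : (lebesgue_measure (`[0%R, 1%R[%classic : set R) <=
    \sum_(0 <= k <oo) lebesgue_measure (J k))%E.
  by apply: measure_sigma_subadditive => // k; have [] := JP k.
apply/negP; rewrite -ltNge lebesgue_measure_itv /= lte_fin ltr01 sube0.
apply: (@le_lt_trans _ _ (\sum_(0 <= k <oo) ((2 * C)%:E * diam_pow s (U k)))%E).
  by apply: lee_nneseries => // k _; have [] := JP k.
rewrite nneseriesZl; last by move=> *; exact: diam_pow_ge0.
by rewrite -lte_pdivlMl// mule1.
Qed.

End hausdorff_facts.

(** The type class of information theory, listed so that a digit can select a word by its
    position. *)
Fixpoint type_class n j : seq (seq bool) :=
  match n, j with
  | 0, 0 => [:: [::]]
  | 0, _.+1 => [::]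
  | n'.+1, 0 => map (cons false) (type_class n' 0)
  | n'.+1, j'.+1 => map (cons true) (type_class n' j') ++
                    map (cons false) (type_class n' j'.+1)
  end.

Lemma size_type_class n j : size (type_class n j) = 'C(n, j).
Proof.
elim: n j => [|n IHn] [|j] //=; first by rewrite size_map IHn !bin0.
by rewrite size_cat !size_map !IHn binS addnC.
Qed.

Lemma type_class_uniq n j : uniq (type_class n j).
Proof.
have injc b : injective (cons b : seq bool -> _) by move=> ? ? [].
elim: n j => [|n IHn] [|j] //=; first by rewrite map_inj_uniq.
rewrite cat_uniq !map_inj_uniq// !IHn/= andbT.
by apply/hasPn => _ /mapP[w _ ->]; apply/mapP => -[].
Qed.

Lemma mem_type_class n j w : w \in type_class n j ->
  size w = n /\ count id w = j.
Proof.
elim: n j w => [|n IHn] [|j] w //=; first by rewrite inE => /eqP->.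
  by move=> /mapP[v /IHn[<- vj] ->] /=; rewrite vj.
by rewrite mem_cat => /orP[] /mapP[v /IHn[<- vj] ->] /=; rewrite vj.
Qed.

Lemma word_wt_type (R : realType) (a : R) w :
  word_wt a w = type_wt a (size w) (count id w).
Proof.
rewrite /type_wt; elim: w => [|b w IHw]; first by rewrite word_wt_nil !mulr1.
rewrite word_wt_cons IHw; have := count_size id w; case: b => /= cs.
  by rewrite exprS mulrA subSS.
by rewrite add0n subSn// exprS mulrCA.
Qed.

(** * Separation and nesting of cylinders *)

Section separation.
Context {R : realType} (a : R).
Hypothesis a01 : 0 < a < 1.

(** Each letter maps [0, 1] into itself and scales the distance to either end of its image by the
    letter weight. *)
Lemma word_map_margin v (m u : R) : 0 <= m -> m <= u <= 1 - m ->
  word_wt a v * m <= word_map a v u <= 1 - word_wt a v * m.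
Proof.
have /andP[a0 a1] := a01.
move=> m0 mu; elim: v => [|b v /andP[IH1 IH2]] /=.
  by rewrite word_wt_nil mul1r.
rewrite word_wt_cons; set W := word_wt a v * m in IH1 IH2.
have W0 : 0 <= W by rewrite mulr_ge0// ltW// word_wt_gt0.
rewrite -mulrA -/W; move: (word_map a v u) IH1 IH2 => X WX XW.
by clear - a0 a1 W0 WX XW; case: b => /=; apply/andP; split; nra.
Qed.

(** Once the common prefix is removed, the points lie on different sides of [a], and the margin
    keeps the first one away from [a] even if the cylinders touch there. *)
Lemma word_map_separated v v' (m u z : R) : size v = size v' -> v != v' ->
  0 <= m -> m <= u <= 1 - m -> 0 <= z <= 1 ->
  word_wt a v * m <= `|word_map a v u - word_map a v' z|.
Proof.
have /andP[a0 a1] := a01.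
move=> + + m0 mu z01; elim: v v' => [|b v IHv] [|b' v'] //= [svv'].
rewrite eqseq_cons; have [<-/= vv'|bb' _] := eqVneq b b'.
  by rewrite tent_inv_dist// word_wt_cons -mulrA ler_pM2l ?letter_wt_gt0// IHv.
rewrite word_wt_cons -mulrA.
have /andP[X0 X1] := word_map_margin v m u m0 mu.
have /andP[Z0 Z1] := word_map01 _ v' _ a01 z01.
have W0 : 0 <= word_wt a v * m by rewrite mulr_ge0// ltW// word_wt_gt0.
move: (word_wt a v * m) (word_map a v u) (word_map a v' z) X0 X1 Z0 Z1 W0.
move=> W X Z X0 X1 Z0 Z1 W0; rewrite ler_normr.
clear - a0 a1 X0 X1 Z0 Z1 W0 bb'.
by case: b b' bb' => -[] //= _; apply/orP; [right|left]; nra.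
Qed.

Lemma word_map_affine v u :
  word_map a v u = word_map a v 0 + u * (word_map a v 1 - word_map a v 0).
Proof.
elim: v => [|b v IHv] /=; first by ring.
by rewrite IHv; case: b => /=; ring.
Qed.

(** The cylinders decrease, and the supremum of their left ends is a common point. *)
Lemma nested_words (W : nat -> seq bool) (B : nat -> seq bool) :
  (forall k, W k.+1 = W k ++ B k) ->
  exists x, forall k, exists2 u, 0 <= u <= 1 & x = word_map a (W k) u.
Proof.
move=> WS.
pose f k u := word_map a (W k) u.
have fS k l : exists2 g, (forall u, 0 <= u <= 1 -> 0 <= g u <= 1) &
    forall u, f (k + l)%N u = f k (g u).
  elim: l => [|l [g g01 gE]]; first by exists id => // u; rewrite addn0.
  exists (g \o word_map a (B (k + l)%N)) => [u u01|u].
    by apply: g01; exact: word_map01.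
  by rewrite addnS /f WS word_map_cat -/(f _ _) gE.
have f_ge k u : 0 <= u <= 1 ->
    Num.min (f k 0) (f k 1) <= f k u <= Num.max (f k 0) (f k 1).
  move=> /andP[u0 u1]; rewrite ge_min le_max /f (word_map_affine _ u).
  move: (word_map a (W k) 0) (word_map a (W k) 1) => X Y.
  clear - u0 u1.
  by have [XY|YX] := leP X Y; apply/andP; split; apply/orP;
    [left|right|right|left]; nra.
(* The letter [false] reverses orientation, so either of the images of 0 and 1 may be the left
   end. *)
pose lo k := Num.min (f k 0) (f k 1); pose hi k := Num.max (f k 0) (f k 1).
have i0 : 0 <= (0 : R) <= 1 by rewrite lexx ler01.
have i1 : 0 <= (1 : R) <= 1 by rewrite lexx ler01.
have lohi k l : lo k <= hi l.
  have lo_kl : lo k <= f (k + l)%N 0 <= hi k.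
    by have [g g01 ->] := fS k l; exact/f_ge/g01.
  have lo_lk : lo l <= f (k + l)%N 0 <= hi l.
    by rewrite addnC; have [g g01 ->] := fS l k; exact/f_ge/g01.
  by case/andP: lo_kl lo_lk => h _ /andP[_]; exact: le_trans.
pose x := sup (range lo).
have xlo k : lo k <= x.
  apply: sup_upper_bound; last by exists k.
  by split; [exists (lo 0%N), 0%N|exists (hi 0%N) => _ [l _ <-]].
have xhi k : x <= hi k.
  by apply: ge_sup => [|_ [l _ <-]]; [exists (lo 0%N), 0%N|].
exists x => k; have := xlo k; have := xhi k; rewrite /lo /hi /f.
rewrite le_max ge_min.
have ne : word_map a (W k) 1 - word_map a (W k) 0 != 0.
  rewrite -normr_eq0 word_map_dist// subr0 normr1 mulr1.
  by rewrite gt_eqF// word_wt_gt0.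
move=> h2 h1; exists ((x - word_map a (W k) 0) /
  (word_map a (W k) 1 - word_map a (W k) 0)).
  move: ne h1 h2; move: (word_map a (W k) 0) (word_map a (W k) 1) => X Y.
  rewrite subr_eq0 => YX; have [XY|XY|XY] := ltgtP X Y;
    last by rewrite XY eqxx in YX.
    by move=> h1 h2; apply: divr_itv01; rewrite ?subr_gt0//; lra.
  move=> h1 h2; rewrite -[X in _ <= X / _ <= _]opprB -[X in _ / X]opprB invrN mulrNN.
  by apply: divr_itv01; rewrite ?subr_gt0//; lra.
by rewrite (word_map_affine _ (_ / _)) divfK//; ring.
Qed.

End separation.

(** * Digits in base M *)

Section digits.
Context {R : realType} (M : nat).
Hypothesis M_ge2 : (2 <= M)%N.
Implicit Types t : R.

Definition digit (t : R) k : nat := (Num.truncn (M%:R ^+ k.+1 * t) %% M)%N.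

Lemma digit_lt t k : (digit t k < M)%N.
Proof. by rewrite ltn_mod; lia. Qed.

Let M0 : (0 : R) < M%:R. Proof. by rewrite ltr0n; lia. Qed.

Lemma truncn_expS t k : 0 <= t ->
  Num.truncn (M%:R ^+ k.+1 * t) = (Num.truncn (M%:R ^+ k * t) * M + digit t k)%N.
Proof.
move=> t0; rewrite /digit [LHS](divn_eq _ M); congr (_ * _ + _)%N.
have y0 : 0 <= M%:R ^+ k * t by rewrite mulr_ge0// exprn_ge0// ltW.
rewrite exprS -mulrA; move: (_ * t) y0 => y y0.
apply/esym/truncn_def.
have My0 : 0 <= M%:R * y by rewrite mulr_ge0// ltW.
have /andP[h1 h2] := truncn_itv My0.
apply/andP; split.
  rewrite -(ler_pM2l M0) -natrM; apply: le_trans h1.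
  by rewrite ler_nat mulnC leq_trunc_div.
rewrite -(ltr_pM2l M0); apply: lt_le_trans h2 _.
by rewrite -natrM ler_nat mulnC ltn_ceil//; lia.
Qed.

(** Equal first k digits give equal integer parts of M^k t and M^k t'. *)
Lemma digits_close t t' k : 0 <= t < 1 -> 0 <= t' < 1 ->
  (forall i, (i < k)%N -> digit t i = digit t' i) ->
  `|t - t'| <= (M%:R ^+ k)^-1.
Proof.
move=> /andP[t0 t1] /andP[t'0 t'1] tt'.
have E : Num.truncn (M%:R ^+ k * t) = Num.truncn (M%:R ^+ k * t').
  elim: k tt' => [|k IHk] tt'.
    by rewrite !mul1r (@truncn_def _ t 0%N) ?t0// (@truncn_def _ t' 0%N) ?t'0.
  by rewrite !truncn_expS// tt'// IHk// => i ik; rewrite tt'// ltnW.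
have Mk0 : (0 : R) < M%:R ^+ k by rewrite exprn_gt0.
rewrite -(ler_pM2l Mk0) divff ?gt_eqF// -{1}[M%:R ^+ k]gtr0_norm// -normrM mulrBr.
have /andP[h1 h2] := @truncn_itv _ (M%:R ^+ k * t) (mulr_ge0 (ltW Mk0) t0).
have /andP[h3 h4] := @truncn_itv _ (M%:R ^+ k * t') (mulr_ge0 (ltW Mk0) t'0).
rewrite E in h1 h2; rewrite -natr1 in h2 h4.
move: h1 h2 h3 h4; move: (_ ^+ _ * t) (_ ^+ _ * t') (_%:R) => X Y Z.
by move=> *; rewrite ler_norml; apply/andP; split; lra.
Qed.

Lemma digits_neq t t' : 0 <= t < 1 -> 0 <= t' < 1 -> t != t' ->
  exists2 k, digit t k != digit t' k &
    forall i, (i < k)%N -> digit t i = digit t' i.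
Proof.
move=> t01 t'01 tt'.
have exk : exists k, digit t k != digit t' k.
  apply: contrapT => /forallNP same.
  have d0 : 0 < `|t - t'| by rewrite normr_gt0 subr_eq0.
  have M01 : 0 < (M%:R^-1 : R) < 1 by rewrite invr_gt0 M0 invf_lt1// ltr1n.
  have [n] := exists_expr_lt _ _ M01 d0; apply/negP; rewrite -leNgt exprVn.
  apply: digits_close => // i _; exact/eqP/negPn/negP/same.
have [k' k'P k'min] := ex_minnP exk.
exists k' => // i ik'; apply/eqP; apply: contraTT ik' => /k'min.
by rewrite -leqNgt.
Qed.

End digits.

Lemma has_derivative_within0P (R : realType) (D : set R) (f : R -> R) (x : R) :
  has_derivative_within D f x 0 <-> forall e, 0 < e ->
    exists2 r, 0 < r & forall y, D y -> `|x - y| < r ->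
      `|f x - f y| <= e * `|x - y|.
Proof.
split=> [/cvgrPdist_le fx e e0|fx].
  have := fx _ e0; rewrite /within /= /dnbhs /within /= => /nbhs_ballP[r /= r0 rP].
  exists r => // y Dy xyr; have [->|xy] := eqVneq x y.
    by rewrite !subrr normr0 mulr0.
  have := rP y; rewrite /ball /= => /(_ xyr); rewrite eq_sym => /(_ xy Dy).
  rewrite sub0r normrN normrM normfV ler_pdivrMr ?normr_gt0 ?subr_eq0 1?eq_sym//.
  by rewrite (distrC (f y)) (distrC y).
apply/cvgrPdist_le => e /fx[r r0 rP].
rewrite /within /= /dnbhs /within /=; apply/nbhs_ballP; exists r => //= y.
rewrite /ball /= => xyr yx Dy.
rewrite sub0r normrN normrM normfV ler_pdivrMr ?normr_gt0 ?subr_eq0//.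
by rewrite (distrC (f y)) (distrC y) rP.
Qed.

(** The cylinder of the word 0 1 is [a^2, a], away from both 0 and 1; as a tail, this word provides
    the margin for [word_map_separated]. *)
Lemma tail_margin (R : realType) (a u : R) : 0 < a < 1 -> 0 <= u <= 1 ->
  let m := a ^+ 2 * (1 - a) in
  m <= word_map a [:: true; false] u <= 1 - m.
Proof.
move=> /andP[a0 a1] /andP[u0 u1] /=; rewrite expr2.
have b0 : 0 <= 1 - a by lra.
have p0 : 0 <= (1 - a) * u by rewrite mulr_ge0.
have p1 : (1 - a) * u <= 1 - a by rewrite ler_piMr.
have aa : a * a <= 1 by rewrite mulr_ile1 ?ltW.
have h1 : a * a * (1 - a) <= a * a by rewrite ler_piMr ?mulr_ge0 ?(ltW a0)//; lra.
have h2 : a * a * (1 - a) <= 1 - a by rewrite ler_piMl.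
apply/andP; split; first by apply: le_trans h1 _; rewrite ler_pM2l//; lra.
by apply: (@le_trans _ _ a); [rewrite ler_piMr ?(ltW a0)//|]; lra.
Qed.

Section lower_bound.
Context {R : realType} (tau tau' : R) (theta : R -> R).
Hypotheses (tau01 : 0 < tau < 1) (tau'01 : 0 < tau' < 1).
Hypothesis neq_tau : tau != tau'.
Hypothesis theta_tent_inv : forall b x, 0 <= x <= 1 ->
  theta (tent_inv tau b x) = tent_inv tau' b (theta x).

(** Were the derivative 0, the ends of a small cylinder I around x would have images at distance at
    most |I| / 2; but these images are the ends of theta I, which is at least as long as I. *)
Lemma derivative_neq0_expanding x :
  (forall e, 0 < e -> exists w u, [/\ 0 <= u <= 1, x = word_map tau w u,
    word_wt tau w < e & word_wt tau w <= word_wt tau' w]) ->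
  derivative_neq0 theta x.
Proof.
have i0 : 0 <= (0 : R) <= 1 by rewrite lexx ler01.
have i1 : 0 <= (1 : R) <= 1 by rewrite lexx ler01.
move=> xP; split.
  have [w [u [u01 -> _ _]]] := xP _ ltr01.
  by rewrite in_itv /=; exact: word_map01.
move=> /has_derivative_within0P /(_ (2^-1)); rewrite invr_gt0 ltr0n => /(_ isT).
move=> [r r0 rP]; have [w [u [u01 xE wr ww]]] := xP _ r0.
have w0 := word_wt_gt0 tau w tau01.
have close z : 0 <= z <= 1 -> `|x - word_map tau w z| = word_wt tau w * `|u - z|.
  by move=> z01; rewrite xE word_map_dist.
have h z : 0 <= z <= 1 -> `|theta x - theta (word_map tau w z)| <=
    2^-1 * (word_wt tau w * `|u - z|).
  move=> z01; rewrite -close//; apply: rP.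
    by rewrite /= in_itv /=; exact: word_map01.
  rewrite close//; apply: le_lt_trans wr; rewrite ler_piMr ?(ltW w0)//.
  by case/andP: u01 z01 => ? ? /andP[? ?]; rewrite ler_norml; apply/andP; split; lra.
have := ler_normB (theta x - theta (word_map tau w 0))
  (theta x - theta (word_map tau w 1)).
have -> : theta x - theta (word_map tau w 0) - (theta x - theta (word_map tau w 1)) =
  theta (word_map tau w 1) - theta (word_map tau w 0) by ring.
rewrite !(theta_word_map _ _ _ tau01 theta_tent_inv)// word_map_dist//.
rewrite (theta_0 _ _ _ tau'01 theta_tent_inv) (theta_1 _ _ _ tau'01 theta_tent_inv).
have := h _ i0; have := h _ i1.
rewrite !(theta_word_map _ _ _ tau01 theta_tent_inv)//.
rewrite (theta_0 _ _ _ tau'01 theta_tent_inv) (theta_1 _ _ _ tau'01 theta_tent_inv).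
rewrite (subr0 1) normr1 mulr1.
have -> : `|u - 1| = 1 - u by rewrite distrC ger0_norm//; case/andP: u01 => *; lra.
have -> : `|u - 0| = u by rewrite subr0 ger0_norm//; case/andP: u01.
by move=> h1 h2 h3; lra.
Qed.

Lemma hausdorff_measure_lower s : 0 <= s -> s < conj_dim tau tau' ->
  hausdorff_measure s (derivative_neq0 theta) <> 0%E.
Proof.
move=> s0 sd.
have [n [j [jn ll' Ml2]]] := good_block _ _ tau01 tau'01 neq_tau s sd s0.
set l := type_wt tau n.+2 j.+1 in ll' Ml2; set l' := type_wt tau' n.+2 j.+1 in ll'.
have l0 : 0 < l by exact: type_wt_gt0.
pose M := 'C(n, j); rewrite -/M in Ml2.
pose tail := [:: true; false].
(* All blocks have the same number of letters of each kind, hence the same weights [l] and [l']. *)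
pose blk i := nth [::] (type_class n j) i ++ tail.
have blkP i : (i < M)%N -> size (nth [::] (type_class n j) i) = n /\
    count id (nth [::] (type_class n j) i) = j.
  by rewrite /M -size_type_class => iM; apply/mem_type_class/mem_nth.
have blk_wt (a : R) i : (i < M)%N -> word_wt a (blk i) = type_wt a n.+2 j.+1.
  move=> /blkP[sz ct]; rewrite word_wt_type size_cat sz count_cat ct/=.
  by rewrite addn1 addn2.
have l1 : l < 1.
  have /andP[t0 t1] := tau01.
  have n0 : (n.+2 - j.+1 != 0)%N by rewrite subSS -lt0n subn_gt0 ltnS.
  have [s0' s1'] : 0 <= 1 - tau /\ 1 - tau < 1 by lra.
  by rewrite mulr_ilt1 ?exprn_ge0 ?exprn_ilt1// ltW.
have ls1 : l `^ s <= 1 by rewrite -(powRr0 l) ger_powR// l0 ltW.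
have M2 : (2 <= M)%N.
  rewrite -(ler_nat R); apply: le_trans Ml2 _.
  by rewrite ler_piMr.
(* One more digit scales t by 1 / M and one more block scales cylinders by [l], so this is the
   Hoelder condition with exponent s. *)
have MV : (M%:R)^-1 <= l `^ s.
  have M0 : (0 : R) < M%:R by rewrite ltr0n ltnW.
  rewrite -(ler_pM2l M0) divff ?gt_eqF//; apply: le_trans Ml2.
  by rewrite ler1n.
pose W (t : R) k := flatten (mkseq (fun i => blk (digit M t i)) k).
have WS t k : W t k.+1 = W t k ++ blk (digit M t k).
  by rewrite /W mkseqS flatten_rcons.
have wtW (a : R) t k : word_wt a (W t k) = type_wt a n.+2 j.+1 ^+ k.
  elim: k => [|k IHk]; first by rewrite word_wt_nil.
  by rewrite WS word_wt_cat IHk blk_wt ?digit_lt// exprSr.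
have /choice[h hP] : forall t : R, exists x, forall k,
    exists2 u, 0 <= u <= 1 & x = word_map tau (W t k) u.
  by move=> t; apply: (nested_words _ tau01 _ (fun k => blk (digit M t k))).
pose m := tau ^+ 2 * (1 - tau).
have /andP[t0 t1] := tau01.
have m0 : 0 < m by rewrite mulr_gt0 ?exprn_gt0//; lra.
(* The gap between points of two different blocks: the weight of a block without its tail times the
   margin. *)
pose delta := type_wt tau n j * m.
have delta0 : 0 < delta by rewrite mulr_gt0// type_wt_gt0.
apply: (hausdorff_measure_neq0 _ s (delta `^ (- s)) h) => //.
- exact: powR_gt0.
- move=> t _; apply: derivative_neq0_expanding => e e0.
  have l01 : 0 < l < 1 by rewrite l0.
  have [k ke] := exists_expr_lt _ _ l01 e0.
  have [u u01 hE] := hP t k; exists (W t k), u; split => //.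
    by rewrite wtW.
  by rewrite !wtW lerXn2r// ?nnegrE ?ltW// type_wt_gt0.
move=> t t' t01 t'01; have [->|tt'] := eqVneq t t'.
  by rewrite subrr normr0 mulr_ge0 ?powR_ge0.
have [k dk dlt] := digits_neq _ M2 _ _ t01 t'01 tt'.
have Wtt' : W t k = W t' k.
  rewrite /W /mkseq; congr flatten; apply/eq_in_map => i.
  by rewrite mem_iota add0n => /= /dlt ->.
have [u u01 hE] := hP t k.+1; have [u' u'01 hE'] := hP t' k.+1.
(* At the first differing digit k, the k common blocks scale by l^k the gap between two different
   blocks. *)
have d_ge : l ^+ k * delta <= `|h t - h t'|.
  rewrite hE hE' !WS -Wtt' !word_map_cat word_map_dist// wtW ler_pM2l ?exprn_gt0//.
  have [sz ct] := blkP _ (digit_lt _ M2 t k).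
  have [sz' ct'] := blkP _ (digit_lt _ M2 t' k).
  rewrite /delta -{1}sz -{2}ct -word_wt_type.
  apply: word_map_separated => //.
  - by rewrite sz sz'.
  - by rewrite nth_uniq ?type_class_uniq// size_type_class digit_lt.
  - exact: ltW.
  - exact: tail_margin.
  - exact: (word_map01 _ tail).
(* The chain is |t - t'| <= M^(-k) <= (l^k)^s <= (|h t - h t'| / delta)^s. *)
apply: le_trans (digits_close _ M2 _ _ _ t01 t'01 dlt) _.
have lk0 : 0 <= l ^+ k by rewrite exprn_ge0// ltW.
apply: (@le_trans _ _ ((l ^+ k) `^ s)).
  rewrite -powR_mulrn ?(ltW l0)// -powRrM mulrC powRrM powR_mulrn ?powR_ge0//.
  by rewrite -exprVn lerXn2r// nnegrE ?powR_ge0// invr_ge0.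
have d_le : l ^+ k <= delta^-1 * `|h t - h t'| by rewrite mulrC ler_pdivlMr.
have dV0 : 0 <= delta^-1 by rewrite invr_ge0 ltW.
rewrite -[- s]mulN1r powRrM powR_inv1 ?(ltW delta0)// -powRM//.
by rewrite ge0_ler_powR// ?nnegrE// mulr_ge0.
Qed.

End lower_bound.

(** * Upper bound *)

Lemma ler_sum_uniq_sub (R : realType) (T : eqType) (f : T -> R) (s t : seq T) :
  (forall x, 0 <= f x) -> uniq s -> {subset s <= t} ->
  \sum_(x <- s) f x <= \sum_(x <- t) f x.
Proof.
move=> f0; elim: s t => [|x s IHs] t /=; first by rewrite big_nil sumr_ge0.
move=> /andP[xs us] st; have xt : x \in t by apply: st; rewrite mem_head.
rewrite (perm_big _ (perm_to_rem xt)) !big_cons lerD2l IHs// => y ys.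
have := st y; rewrite (perm_mem (perm_to_rem xt)) !inE ys orbT => /(_ isT).
by case/orP => // /eqP yx; rewrite -yx ys in xs.
Qed.

Fixpoint all_words n : seq (seq bool) :=
  if n is n'.+1 then
    map (cons true) (all_words n') ++ map (cons false) (all_words n')
  else [:: [::]].

Lemma mem_all_words w : w \in all_words (size w).
Proof.
elim: w => [|b w IHw] //=; rewrite mem_cat; apply/orP.
by case: b; [left|right]; rewrite map_f.
Qed.

Section word_sums.
Context {R : realType} (a b : R).
Hypotheses (a01 : 0 < a < 1) (b01 : 0 < b < 1).

(** The two letter weights add up to 1. The factor [F] is general so that the induction can shift
    the length by one. *)
Lemma sum_all_words n (F : nat -> R) :
  \sum_(w <- all_words n) word_wt a w * F (size w) = F n.
Proof.
elim: n F => [|n IHn] F /=; first by rewrite big_seq1 word_wt_nil mul1r.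
rewrite big_cat !big_map /=.
have E c : \sum_(w <- all_words n) word_wt a (c :: w) * F (size w).+1 =
    letter_wt a c * F n.+1.
  rewrite -(IHn (fun k => F k.+1)) mulr_sumr.
  by apply: eq_bigr => w _; rewrite word_wt_cons mulrA.
by rewrite !E /=; ring.
Qed.

Lemma sum_geometric_le N K : \sum_(N <= n < N + K) b ^+ n <= b ^+ N / (1 - b).
Proof.
have /andP[b0 b1] := b01; have c0 : 0 < 1 - b by lra.
rewrite ler_pdivlMr// (_ : _ * _ = b ^+ N - b ^+ (N + K)).
  by rewrite gerBl exprn_ge0// ltW.
elim: K => [|K IHK]; first by rewrite addn0 big_geq// subrr mul0r.
by rewrite addnS big_nat_recr ?leq_addr//= mulrDl IHK exprS; ring.
Qed.

(** The words counted are among all words of lengths N to N + L, and the generation n contributes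
    b^n in total. *)
Lemma sum_uniq_words (s : seq (seq bool)) N : uniq s -> 
  \sum_(w <- s | (N <= size w)%N) word_wt a w * b ^+ size w <= b ^+ N / (1 - b).
Proof.
move=> us; pose L := \max_(w <- s) size w.
apply: le_trans (sum_geometric_le N L.+1).
pose t := flatten [seq all_words n | n <- index_iota N (N + L.+1)].
have -> : \sum_(N <= n < N + L.+1) b ^+ n =
    \sum_(w <- t) word_wt a w * b ^+ size w.
  rewrite big_flatten big_map; apply: eq_bigr => n _.
  by rewrite (sum_all_words n (fun n => b ^+ n)).
rewrite -big_filter; apply: ler_sum_uniq_sub.
- move=> w; rewrite mulr_ge0 ?exprn_ge0 ?(ltW (word_wt_gt0 _ _ _))//.
  by rewrite ltW//; case/andP: b01.
- exact: filter_uniq.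
move=> w; rewrite mem_filter => /andP[Nw ws]; apply/flatten_mapP.
exists (size w); last exact: mem_all_words.
rewrite mem_index_iota Nw/= addnS ltnS (leq_trans _ (leq_addl _ _))//.
by rewrite /L (big_rem w ws) leq_maxl.
Qed.

End word_sums.

(** * Covers by cylinders *)

Section cylinder_cover.
Context {R : realType} (tau : R).
Hypothesis tau01 : 0 < tau < 1.

Definition cylinder (w : seq bool) : set R := word_map tau w @` `[0, 1].

Lemma diam_cylinder w : (diam (cylinder w) <= (word_wt tau w)%:E)%E.
Proof.
apply: ge_ereal_sup => _ [[x y] /= [[u u01 <-] [v v01 <-]] <-] /=.
rewrite lee_fin word_map_dist// ler_piMr ?(ltW (word_wt_gt0 _ _ _))//.
move: u01 v01; rewrite /= !in_itv /= => /andP[? ?] /andP[? ?].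
by rewrite ler_norml; apply/andP; split; lra.
Qed.

Lemma diam_set0_le (x : \bar R) : (diam (set0 : set R) <= x)%E.
Proof. by apply: ge_ereal_sup => _ [[? ?] [[]]]. Qed.

Lemma diam_pow_cylinder s w : 0 <= s ->
  (diam_pow s (cylinder w) <= (word_wt tau w `^ s)%:E)%E.
Proof.
move=> s0; have C0 : cylinder w (word_map tau w 0).
  by exists 0 => //; rewrite /= in_itv /= lexx ler01.
have d1 : (diam (cylinder w) <= 1%:E)%E.
  by apply: le_trans (diam_cylinder w) _; rewrite lee_fin word_wt_le1.
have [r r0 [rE ->]] := diam_pow_fin _ s _ C0 d1.
rewrite lee_fin ge0_ler_powR// ?nnegrE ?(ltW (word_wt_gt0 _ _ _))//.
by rewrite -lee_fin -rE diam_cylinder.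
Qed.

Lemma hausdorff_measure_ge0 s (A : set R) : (0 <= hausdorff_measure s A)%E.
Proof.
apply: (@le_trans _ _ (hausdorff_premeasure s 1 A)).
  apply: le_ereal_inf_tmp => _ [U _ <-].
  by apply: nneseries_ge0 => *; exact: diam_pow_ge0.
by apply: ereal_sup_ubound; exists 1 => /=.
Qed.

(** |I|^s is dominated by a Bernoulli weight times b^n for words of length n, so the cover by [G N]
    has sum at most b^N / (1 - b), whether or not its cylinders overlap. *)
Lemma hausdorff_measure_eq0 (A : set R) (G : nat -> set (seq bool)) a b r s :
  0 < a < 1 -> 0 < b < 1 -> 0 < r < 1 -> 0 <= s ->
  (forall N w, G N w -> (N <= size w)%N) ->
  (forall N w, G N w -> word_wt tau w <= r ^+ size w) ->
  (forall N w, G N w -> word_wt tau w `^ s <= word_wt a w * b ^+ size w) ->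
  (forall N, A `<=` \bigcup_(w in G N) cylinder w) ->
  hausdorff_measure s A = 0%E.
Proof.
move=> a01 b01 r01 s0 GN Gr Gs AG; apply/eqP.
rewrite eq_le hausdorff_measure_ge0 andbT.
apply: ge_ereal_sup => _ [delta /= d0 <-].
apply/lee_addgt0Pr => e e0; rewrite add0e.
have /andP[b0 b1] := b01; have /andP[r0 r1] := r01.
have c0 : 0 < 1 - b by lra.
have ec0 : 0 < e * (1 - b) by rewrite mulr_gt0.
have [N1 N1e] := exists_expr_lt _ _ b01 ec0.
have [N2 N2d] := exists_expr_lt _ _ r01 d0.
(* [N1] makes the sum at most [e], and [N2] makes the diameters at most [delta]. *)
pose N := maxn N1 N2.
(* Words are enumerated by their codes; a number that codes no word of [G N] gets the empty set,
   whose [diam_pow] is 0. *)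
pose U k := if @pickle_inv (seq bool) k is Some w then
  (if `[< G N w >] then cylinder w else set0) else set0.
pose F k : R := if @pickle_inv (seq bool) k is Some w then
  (if (N <= size w)%N then word_wt a w * b ^+ size w else 0) else 0.
have wt0 w : 0 <= word_wt a w * b ^+ size w.
  by rewrite mulr_ge0 ?exprn_ge0 ?(ltW (word_wt_gt0 _ _ _))// ltW.
have UF k : (diam_pow s (U k) <= (F k)%:E)%E.
  have z : diam_pow s (set0 : set R) = 0%E by rewrite /diam_pow eqxx.
  rewrite /U /F; case: pickle_inv => [w|]; last by rewrite z.
  case: asboolP => [Gw|_]; last by rewrite z lee_fin; case: ifP.
  rewrite (GN _ _ Gw); apply: le_trans (diam_pow_cylinder _ _ s0) _.
  by rewrite lee_fin; exact: Gs Gw.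
apply: (@le_trans _ _ (\sum_(0 <= k <oo) diam_pow s (U k))%E).
  apply: ereal_inf_lbound; exists U => //; split.
    move=> x /(AG N)[w Gw wx]; exists (pickle w) => //.
    by rewrite /U pickleK_inv asboolT.
  move=> k; rewrite /U; case: pickle_inv => [w|].
    case: asboolP => [Gw|_].
      apply: le_trans (diam_cylinder w) _; rewrite lee_fin.
      apply: le_trans (Gr _ _ Gw) _; apply: ltW; apply: le_lt_trans N2d.
      by rewrite ler_wiXn2l ?ltW// (leq_trans _ (GN _ _ Gw))// leq_maxr.
    exact: diam_set0_le.
  exact: diam_set0_le.
apply: lime_le; first by apply: is_cvg_nneseries => *; exact: diam_pow_ge0.
apply: nearW => K.
apply: le_trans (lee_sum _ (fun k _ => UF k)) _.
rewrite sumEFin lee_fin.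
(* The codes below K decode to a finite list of distinct words, so [sum_uniq_words] bounds every
   partial sum. *)
have -> : \sum_(0 <= k < K) F k =
    \sum_(w <- pmap (@pickle_inv (seq bool)) (index_iota 0 K) | (N <= size w)%N)
      word_wt a w * b ^+ size w.
  elim: (index_iota 0 K) => [|k l IHl]; first by rewrite !big_nil.
  rewrite big_cons IHl /= /F; case: pickle_inv => [w|] /=; last by rewrite add0r.
  by rewrite big_cons; case: ifP => // _; rewrite add0r.
apply: le_trans (sum_uniq_words _ _ a01 b01 _ _ _) _.
  by apply: (pmap_uniq (@pickle_invK _)); exact: iota_uniq.
rewrite ler_pdivrMr//; apply: ltW; apply: le_lt_trans N1e.
by rewrite ler_wiXn2l ?ltW// leq_maxl.
Qed.

End cylinder_cover.

Section upper_bound.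
Context {R : realType} (tau tau' : R) (theta : R -> R).
Hypotheses (tau01 : 0 < tau < 1) (tau'01 : 0 < tau' < 1).
Hypothesis neq_tau : tau != tau'.
Hypothesis theta01 : forall x, 0 <= x <= 1 -> 0 <= theta x <= 1.
Hypothesis theta_tent_inv : forall b x, 0 <= x <= 1 ->
  theta (tent_inv tau b x) = tent_inv tau' b (theta x).

(** Points y arbitrarily close to x satisfy |theta x - theta y| > e |x - y|, and [commensurable_ne]
    then gives a cylinder I around x with |theta I| at least a fixed multiple of |I|. For long words
    exp (- eps n) is below this multiple. *)
Lemma derivative_neq0_words eps : 0 < eps -> forall N x,
  derivative_neq0 theta x -> exists w u, [/\ 0 <= u <= 1,
    x = word_map tau w u, (N <= size w)%N &
    word_wt tau w * expR (- (eps * (size w)%:R)) <= word_wt tau' w].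
Proof.
move=> eps0 N x [x01 nder].
have /existsNP[e /not_implyP[e0 eP]] : ~ forall e, 0 < e ->
    exists2 r, 0 < r & forall y, `[0, 1]%classic y -> `|x - y| < r ->
      `|theta x - theta y| <= e * `|x - y|.
  by move=> h; apply: nder; apply/has_derivative_within0P.
have far r : 0 < r -> exists y, [/\ 0 <= y <= 1, `|x - y| < r &
    e * `|x - y| < `|theta x - theta y|].
  move=> r0; apply: contrapT => no; apply: eP; exists r => // y y01 xyr.
  by rewrite leNgt; apply/negP => h; apply: no; exists y; split => //.
have /andP[t0 t1] := tau01; have /andP[t'0 t'1] := tau'01.
pose k1 := tau ^+ 2 * (1 - tau) ^+ 2; pose k2 := tau' * (1 - tau') ^+ 2.
have k10 : 0 < k1 by rewrite mulr_gt0// exprn_gt0// subr_gt0.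
have k20 : 0 < k2 by rewrite mulr_gt0// exprn_gt0// subr_gt0.
have exp01 : 0 < expR (- eps) < 1 by rewrite expR_gt0 expR_lt1 oppr_lt0.
have k0 : 0 < k1 * (k2 * e) by apply: mulr_gt0 => //; apply: mulr_gt0.
have [N1 N1P] := exists_expr_lt _ _ exp01 k0.
pose c := Num.min tau (1 - tau).
have /andP[c0 c1] : 0 < c < 1 := min_letter01 _ tau01.
(* A word of length n has weight at least c^n, so this closeness forces the length to be at least
   [maxn N N1]. *)
have [|y [y01 xy exy]] := far (k1 * c ^+ maxn N N1).
  by rewrite mulr_gt0// exprn_gt0.
have x01' : 0 <= x <= 1 by move: x01; rewrite in_itv.
have xNy : x != y.
  by apply: contraTneq exy => ->; rewrite !subrr !normr0 mulr0 ltxx.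
have [w [w' [u [u' [[u01 _ xE _] [h1 _ h2 _]]]]]] :=
  commensurable_ne _ _ _ tau01 tau'01 theta01 theta_tent_inv _ _ x01' y01 xNy.
have w0 := word_wt_gt0 _ w tau01.
have Nw : (maxn N N1 <= size w)%N.
  rewrite leqNgt; apply/negP => wN; move: (le_lt_trans h1 xy).
  rewrite ltr_pM2l// ltNge (le_trans _ (word_wt_ge _ tau01 w))//.
  by rewrite ler_wiXn2l ?(ltW c0) ?(ltW c1) ?(ltnW wN).
exists w, u; split => //; first exact: leq_trans (leq_maxl _ _) Nw.
apply: (le_trans _ h2).
apply: (@le_trans _ _ (k2 * (e * (k1 * word_wt tau w)))); last first.
  by rewrite ler_pM2l//; apply: le_trans (ltW exy); rewrite ler_pM2l.
rewrite (_ : k2 * _ = word_wt tau w * (k1 * (k2 * e))); last by ring.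
rewrite ler_pM2l//; apply: le_trans (ltW N1P).
rewrite -mulNr expRM_natr; have /andP[? ?] := exp01.
by apply: ler_wiXn2l; rewrite ?ltW// (leq_trans (leq_maxr _ _) Nw).
Qed.

Lemma hausdorff_measure_upper s : conj_dim tau tau' < s -> 0 <= s ->
  hausdorff_measure s (derivative_neq0 theta) = 0%E.
Proof.
move=> ds s0.
have p01 := p_weight01 _ _ tau01 tau'01 neq_tau.
have [t t0 tilt] := ln_word_wt_tilt _ _ tau01 tau'01 neq_tau.
pose r := Num.max tau (1 - tau).
have r01 : 0 < r < 1 := max_letter01 _ tau01.
have lr0 : 0 < - ln r by rewrite oppr_gt0 ln_lt0.
(* Per letter, |I|^(s - d) gains a factor of at most exp (- kappa), while the bound |theta I| >= exp
   (- eps n) |I| costs exp (t eps) in the tilt; [eps] is chosen so that t eps < kappa. *)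
pose kappa := (s - conj_dim tau tau') * - ln r.
have kappa0 : 0 < kappa by rewrite mulr_gt0 ?subr_gt0.
pose eps := kappa / (t + 1).
have t10 : 0 < t + 1 by rewrite ltr_wpDl.
have eps0 : 0 < eps by rewrite divr_gt0.
pose b := expR (t * eps - kappa).
have b01 : 0 < b < 1.
  rewrite expR_gt0 expR_lt1 subr_lt0 /eps mulrA ltr_pdivrMr// mulrC.
  by rewrite ltr_pM2l// ltrDl ltr01.
pose G N w := (N <= size w)%N /\
  word_wt tau w * expR (- (eps * (size w)%:R)) <= word_wt tau' w.
apply: (hausdorff_measure_eq0 _ tau01 _ G _ b r s p01 b01 r01 s0).
- by move=> N w [].
- by move=> N w _; exact: word_wt_le.
- move=> N w [_ Gw].
  have w0 := word_wt_gt0 _ w tau01; have w'0 := word_wt_gt0 _ w tau'01.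
  have wp0 := word_wt_gt0 _ w p01.
  rewrite /powR gt_eqF// -[word_wt (p_weight _ _) w]lnK//.
  rewrite -expRM_natr -expRD ler_expR.
  have h1 : - (eps * (size w)%:R) <= ln (word_wt tau' w) - ln (word_wt tau w).
    rewrite -(expRK (- _)) -ln_div ?posrE// ler_ln ?posrE ?expR_gt0 ?divr_gt0//.
    by rewrite ler_pdivlMr// mulrC.
  have h2 : ln (word_wt tau w) <= (size w)%:R * ln r.
    have r0 : 0 < r by case/andP: r01.
    by rewrite mulr_natl -lnXn// ler_ln ?posrE ?exprn_gt0//; exact: word_wt_le.
  have h3 : t * - (eps * (size w)%:R) <=
      t * (ln (word_wt tau' w) - ln (word_wt tau w)).
    exact: ler_wpM2l.
  have h4 : (s - conj_dim tau tau') * ln (word_wt tau w) <=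
      (s - conj_dim tau tau') * ((size w)%:R * ln r).
    by rewrite ler_wpM2l// subr_ge0 ltW.
  rewrite tilt /kappa.
  by move: h3 h4; clear; lra.
move=> N x /(derivative_neq0_words _ eps0 N)[w [u [u01 xE Nw Gw]]].
by exists w => //; exists u; rewrite /= ?in_itv.
Qed.

End upper_bound.

(** * The functional equation of the conjugacy *)

Section functional_equation.
Context {R : realType} (tau tau' : R) (theta : R -> R).
Hypotheses (tau01 : 0 < tau < 1) (tau'01 : 0 < tau' < 1).
Hypothesis conj_theta : is_conjugacy tau tau' theta.

Lemma conjugacy01 x : 0 <= x <= 1 -> 0 <= theta x <= 1.
Proof.
case: conj_theta => -[th01 _ _ _] _ _ x01.
by have := th01 x; rewrite /= !in_itv /=; apply.
Qed.

(** 0 is the image of [g 0]; if [g 0] were positive, monotonicity would make theta 0 negative. *)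
Lemma conjugacy_0 : theta 0 = 0.
Proof.
case: conj_theta => -[_ th_inc _ [g [g01 _ _ gK]]] _ _.
have i0 : (0 : R) \in `[0, 1] by rewrite in_itv /= lexx ler01.
have /= := g01 0 i0; rewrite in_itv /= => /andP[g0 g1].
have [g00|gne] := eqVneq (g 0) 0; first by rewrite -{1}g00 gK.
have : theta 0 < theta (g 0).
  by apply: th_inc => //; rewrite ?in_itv /= ?g0 ?g1// lt_neqAle eq_sym gne.
rewrite gK// => th0; have := conjugacy01 0; rewrite lexx ler01 => /(_ isT).
by rewrite leNgt th0.
Qed.

Lemma conjugacy_1 : theta 1 = 1.
Proof.
case: conj_theta => -[_ th_inc _ [g [g01 _ _ gK]]] _ _.
have i1 : (1 : R) \in `[0, 1] by rewrite in_itv /= lexx ler01.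
have /= := g01 1 i1; rewrite in_itv /= => /andP[g0 g1].
have [g11|gne] := eqVneq (g 1) 1; first by rewrite -{1}g11 gK.
have : theta (g 1) < theta 1.
  by apply: th_inc => //; rewrite ?in_itv /= ?g0 ?g1// lt_neqAle gne.
rewrite gK// => th1; have := conjugacy01 1; rewrite lexx ler01 => /(_ isT).
by rewrite [_ <= 1]leNgt th1 andbF.
Qed.

Lemma branch_ex x : 0 < x <= 1 -> exists k, branch tau k.+1 x.
Proof.
move=> /andP[x0 x1].
have [n nx nmin] := ex_minnP (exists_expr_lt _ _ tau01 x0).
case: n nx nmin => [|n] nx nmin; first by move: nx; rewrite expr0 ltNge x1.
exists n; rewrite /branch /= in_itv /= nx leNgt; apply/negP => /nmin.
by rewrite ltnn.
Qed.

(** The inverse of the branch k + 1 is y |-> tau^k (1 - (1 - tau) y), the map of the word 0^k 1, and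
    theta carries branches to branches. *)
Lemma conjugacy_branch k x : branch tau k.+1 x ->
  [/\ x = tau ^+ k * (1 - (1 - tau) * markov_map tau x),
      0 <= markov_map tau x <= 1 &
      theta x = tau' ^+ k * (1 - (1 - tau') * theta (markov_map tau x))].
Proof.
have inv (a y : R) : 0 < a < 1 -> branch a k.+1 y ->
    y = a ^+ k * (1 - (1 - a) * markov_map a y) /\ 0 <= markov_map a y < 1.
  move=> a01 yb; rewrite (markov_map_branch a01 _ yb)//=.
  have /andP[a0 a1] := a01; have ak0 : 0 < a ^+ k by rewrite exprn_gt0.
  have b0 : 0 < 1 - a by lra.
  split; first by field; rewrite !gt_eqF//; lra.
  move: yb; rewrite /branch /= in_itv /= exprS => /andP[y1 y2].
  have d0 : 0 < a ^+ k * (1 - a) by rewrite mulr_gt0.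
  rewrite divr_ge0 ?subr_ge0 ?(ltW d0)//= ltr_pdivrMr// mul1r.
  lra.
move=> xb; have [xE /andP[T0 T1]] := inv _ _ tau01 xb.
have thb : branch tau' k.+1 (theta x).
  by case: conj_theta => _ _ <- //; exists x.
have [thE _] := inv _ _ tau'01 thb.
split=> //; first by rewrite T0 ltW.
rewrite {1}thE; case: conj_theta => _ -> //.
rewrite in_itv /=; move: xb; rewrite /branch /= in_itv /= => /andP[x0 x1].
have /andP[t0 t1] := tau01.
rewrite (ltW (lt_trans _ x0)) ?exprn_gt0//=.
by apply: le_trans x1 _; rewrite exprn_ile1// ltW.
Qed.

(** Multiplying a positive point by [tau] moves it to the next branch without changing its image
    under [markov_map], which settles [true]. For [false], the map x |-> 1 - (1 - tau) x inverts the
    first branch. *)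
Lemma conjugacy_tent_inv b x : 0 <= x <= 1 ->
  theta (tent_inv tau b x) = tent_inv tau' b (theta x).
Proof.
have /andP[t0 t1] := tau01; have /andP[t'0 t'1] := tau'01.
have thT y : 0 <= y <= 1 -> theta (tau * y) = tau' * theta y.
  move=> /andP[]; rewrite le_eqVlt => /orP[/eqP<- _|y0 y1].
    by rewrite mulr0 conjugacy_0 mulr0.
  have [k yb] : exists k, branch tau k.+1 y by apply: branch_ex; rewrite y0.
  have tyb : branch tau k.+2 (tau * y).
    move: yb; rewrite /branch /= !in_itv /= !exprS => /andP[h1 h2].
    by rewrite ltr_pM2l// h1 ler_pM2l.
  have [yE T01 thE] := conjugacy_branch _ _ yb.
  have [tyE _ thtE] := conjugacy_branch _ _ tyb.
  rewrite thtE thE exprS -mulrA; congr (_ * (_ * (1 - _ * theta _))).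
  rewrite (markov_map_branch tau01 _ yb)// (markov_map_branch tau01 _ tyb)//=.
  by rewrite exprS; field; rewrite !gt_eqF ?exprn_gt0//; lra.
case: b => /= x01; first exact: thT.
(* For x = 1 the point is [tau], which belongs to the second branch, so it is treated as tau * 1. *)
move: (x01) => /andP[x0]; rewrite le_eqVlt => /orP[/eqP->|x1].
  rewrite conjugacy_1 (_ : 1 - _ = tau * 1); last by ring.
  by rewrite thT ?ler01 ?lexx// conjugacy_1; ring.
have yb : branch tau 1 (1 - (1 - tau) * x).
  by rewrite /branch /= in_itv /= expr0 expr1; apply/andP; split; nra.
have [_ _ ->] := conjugacy_branch _ _ yb.
rewrite expr0 mul1r (markov_map_branch tau01 _ yb)//= expr0 mul1r.
congr (1 - _ * theta _); field; lra.
Qed.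

End functional_equation.

Theorem theorem1p6 (R : realType) (tau tau' : R)
    (tau01 : 0 < tau < 1) (tau'01 : 0 < tau' < 1) (neq_tau : tau <> tau')
    (theta : R -> R) (conj_theta : is_conjugacy tau tau' theta) :
  let p := p_weight tau tau' in
  hausdorff_dim (derivative_neq0 theta) =
    ((p * ln p + (1 - p) * ln (1 - p)) /
     (p * ln tau + (1 - p) * ln (1 - tau)))%:E.
Proof.
move=> p; have tau_neq : tau != tau' by exact/eqP.
have theta01 := conjugacy01 _ _ _ conj_theta.
have theta_tent := conjugacy_tent_inv _ _ _ tau01 tau'01 conj_theta.
have -> : (p * ln p + (1 - p) * ln (1 - p)) / (p * ln tau + (1 - p) * ln (1 - tau)) =
    conj_dim tau tau'.
  by rewrite /conj_dim /entropy /cross_entropy invrN mulrNN.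
have d0 : 0 <= conj_dim tau tau'.
  have p01 := p_weight01 _ _ tau01 tau'01 tau_neq.
  by rewrite divr_ge0 ?ltW// cross_entropy_gt0.
apply/eqP; rewrite eq_le; apply/andP; split.
  apply/lee_addgt0Pr => e e0; rewrite -EFinD.
  apply: ereal_inf_lbound; exists (conj_dim tau tau' + e) => //; split.
    by rewrite addr_ge0 ?(ltW e0).
  apply: (hausdorff_measure_upper _ _ _ tau01 tau'01 tau_neq theta01 theta_tent).
    by rewrite ltrDl.
  by rewrite addr_ge0 ?(ltW e0).
apply: le_ereal_inf_tmp => _ [s [s0 Hs] <-]; rewrite lee_fin leNgt.
apply/negP => sd; move: Hs.
exact: (hausdorff_measure_lower _ _ _ tau01 tau'01 tau_neq theta_tent).
Qed.
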